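(* Let $X$ be a compact CAT(0) cube complex with a pair of diametrically opposed vertices $v,v^*$, and suppose that $\mathrm{Aut}_{v,v^*}(X)$ is non-solvable. Then the group $\mathbb{Z}\ltimes\Sigma_X\cong \mathrm{Aut}_{v,v^*}(X)\wr\mathbb{Z}$ acts essentially and cocompactly on the finite dimensional CAT(0) cube complex $\mathcal{L}[X]$, is not virtually solvable, and satisfies a law. Consequently, the Girth Alternative fails for the class of (finitely generated) groups acting cocompactly on finite dimensional CAT(0) cube complexes: there is such a group that is not virtually solvable and has finite girth. As a special instance, for $X=[0,1]^m$ with its pair of opposite vertices $v=(0,\dots,0)$, $v^*=(1,\dots,1)$ one has $\mathrm{Aut}_{v,v^*}(X)\cong S_m$, so for $m\ge 5$ the group $\mathbb{Z}\ltimes\Sigma_X\cong S_m\wr\mathbb{Z}$ provides such an example.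
   Context: A cube complex is a cell complex whose cells are cubes $[0,1]^k$ glued along faces by isometries, with the induced path metric $d$; it is CAT(0) if it is a CAT(0) space for $d$. A hyperplane $\hat{\mathfrak h}$ is an equivalence class of edges under the transitive closure of ''being opposite edges of a square'', identified with the union of the corresponding midcubes; it separates $X$ into two components, whose closures are the halfspaces bounded by $\hat{\mathfrak h}$. Vertices $v,v^*$ of $X$ are diametrically opposed if every hyperplane of $X$ separates $v$ from $v^*$. $\mathrm{Aut}_{v,v^*}(X)$ is the group of cubical automorphisms of $X$ fixing both $v$ and $v^*$. $\mathcal{L}[X]$ is obtained from copies $X_i$ ($i\in\mathbb Z$) of $X$, with $v_i,v_i^*\in X_i$ the copies of $v,v^*$, by identifying $v_i^*$ with $v_{i+1}$ for all $i\in\mathbb Z$. $\Sigma_X=\bigoplus_{i\in\mathbb Z}\mathrm{Aut}_{v,v^*}(X)$ acts on $\mathcal L[X]$ with the $i$-th summand acting on $X_i$, and $\mathbb Z$ acts on $\mathcal{L}[X]$ by shifting the copies of $X$ ($X_i\to X_{i+1}$ for the generator); together they generate an action of $\mathbb{Z}\ltimes\Sigma_X$, where $\mathbb Z$ acts on $\Sigma_X$ by shifting coordinates, given by $(\sigma,\tau^k)\cdot x=\sigma\tau^k\cdot x$. $\wr$ denotes the restricted wreath product. An action is cocompact if the translates of some compact subcomplex cover the complex, and essential if for every halfspace $\mathfrak h$ the orbit of a vertex contains points of $\mathfrak h$ at arbitrarily large distance from $\hat{\mathfrak h}$. A group $\Gamma$ satisfies a law if there is a non-trivial element $w(x_1,\dots,x_r)$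 of a free group on $x_1,\dots,x_r$ with $w(\gamma_1,\dots,\gamma_r)=1$ for all $\gamma_1,\dots,\gamma_r\in\Gamma$. A class of finitely generated groups satisfies the Girth Alternative if every group in it is either virtually solvable or of infinite girth. For a finitely generated group $\Gamma$, $\mathrm{Girth}(\Gamma)$ is the supremum over finite generating sets $S$ of the length of the shortest nonempty freely reduced word in $S\cup S^{-1}$ representing the identity in $\Gamma$ ($\infty$ if there is none). *)

(* Defs.v *)
From HB Require Import structures.
From mathcomp Require Import all_boot all_order all_algebra all_fingroup.
From mathcomp Require Import all_classical all_reals all_analysis.
From Stdlib Require Import Relation_Operators.

Set Implicit Arguments.
Unset Strict Implicit.
Unset Printing Implicit Defensive.

Import Order.TTheory GRing.Theory Num.Theory.

Local Open Scope classical_set_scope.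
Local Open Scope ring_scope.

Section EuclideanCube.
Context {R : realType}.

(* The library norm on row vectors is the sup norm. *)
Definition euclid n (a b : 'rV[R]_n) : R :=
  Num.sqrt (\sum_i (a ord0 i - b ord0 i) ^+ 2).

Definition cube n := {a : 'rV[R]_n | [forall i, 0 <= a ord0 i <= 1]}.

Definition ccoord n (a : cube n) (i : 'I_n) : R := val a ord0 i.

Definition cdist n (a b : cube n) : R := euclid (val a) (val b).

Lemma ccoord_itv n (a : cube n) i : 0 <= ccoord a i <= 1.
Proof. by case: a => a aP; rewrite /ccoord /=; move/forallP: aP. Qed.

Lemma mkcube_subproof n (f : 'I_n -> R) : (forall i, 0 <= f i <= 1) ->
  [forall i, 0 <= (\row_j f j) ord0 i <= 1].
Proof. by move=> fP; apply/forallP => i; rewrite mxE. Qed.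

Definition mkcube n (f : 'I_n -> R) (fP : forall i, 0 <= f i <= 1) : cube n :=
  exist _ (\row_j f j) (mkcube_subproof fP).

Lemma origin_subproof n (i : 'I_n) : 0 <= (0 : R) <= 1.
Proof. by rewrite lexx ler01. Qed.

Definition origin n : cube n := mkcube (@origin_subproof n).

Definition cube_interior n (a : cube n) := forall i, 0 < ccoord a i < 1.

(* A face of [0,1]^n: the coordinate i is free if F i = None and is fixed to 0
   (resp. 1) if F i = Some false (resp. Some true). *)
Definition face n := {ffun 'I_n -> option bool}.

Definition in_face n (F : face n) : set (cube n) :=
  [set a | forall i b, F i = Some b -> ccoord a i = b%:R].

Definition facet n (i : 'I_n) (b : bool) : face n :=
  [ffun j => if j == i then Some b else None].

Definition cube_isometry m n (g : cube m -> cube n) :=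
  forall a b, cdist (g a) (g b) = cdist a b.

End EuclideanCube.
Arguments cube R n : clear implicits.
Arguments origin {R} n.

(* The data of a cell complex with cubical cells; [chart c] is the
   characteristic map of the cell c.  The axioms are in [cube_complex]. *)
Record complex (R : realType) := Complex {
  pt : Type;
  cell : Type;
  cdim : cell -> nat;
  chart : forall c : cell, cube R (cdim c) -> pt
}.
Arguments cdim {R c0} _ : rename.
Arguments chart {R c0} c _ : rename.

Section CubeComplex.
Context {R : realType}.
Implicit Types X : complex R.

(* c' is the face F of c: the two characteristic maps agree up to an isometry
   of the cube of c' onto F. *)
Definition face_of X (c : cell X) (F : face (cdim c)) (c' : cell X) :=
  exists g : cube R (cdim c') -> cube R (cdim c),
    [/\ cube_isometry g, range g = in_face F &
        forall a, chart c (g a) = chart c' a].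

(* The open cells partition the space and each is the injective image of an
   open cube; the faces of a cell are cells, attached by isometries. *)
Definition cube_complex X :=
  (forall x : pt X, exists! p : {c : cell X & cube R (cdim c)},
     cube_interior (projT2 p) /\ chart (projT1 p) (projT2 p) = x) /\
  (forall (c : cell X) (F : face (cdim c)), exists c', face_of F c').

Definition finite_dimensional X := exists N, forall c : cell X, (cdim c <= N)%N.

Definition is_vertex X (c : cell X) := cdim c = 0%N.

(* The point carried by a vertex. *)
Definition vpt X (c : cell X) : pt X := chart c (origin (cdim c)).

(* Piecewise linear paths from x to y, each piece being a segment of a cell,
   with their length. *)
Inductive plpath X : pt X -> pt X -> R -> Prop :=
| plpath_nil x : plpath x x 0
| plpath_cons c (a b : cube R (cdim c)) y l :
    plpath (chart c b) y l -> plpath (chart c a) y (cdist a b + l).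

(* The path metric, with value +oo between points that no path joins. *)
Definition dist X (x y : pt X) : \bar R :=
  ereal_inf [set l%:E | l in [set l | plpath x y l]].

Definition dball X (x : pt X) (e : R) (y : pt X) := (dist x y < e%:E)%E.

Lemma cdistxx n (a : cube R n) : cdist a a = 0.
Proof.
rewrite /cdist /euclid big1 ?sqrtr0 // => i _.
by rewrite subrr expr0n.
Qed.

Lemma cdistC n (a b : cube R n) : cdist a b = cdist b a.
Proof.
by congr Num.sqrt; apply: eq_bigr => i _; rewrite -sqrrN opprB.
Qed.

Lemma plpath_cat X (x y z : pt X) k l :
  plpath x y k -> plpath y z l -> plpath x z (k + l).
Proof.
elim=> [x0|c a b y0 k0 _ IH] yz; first by rewrite add0r.
by rewrite -addrA; apply: plpath_cons; exact: IH.
Qed.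

Lemma plpath_rev X (x y : pt X) l : plpath x y l -> plpath y x l.
Proof.
elim=> [x0|c a b y0 k0 _ IH]; first exact: plpath_nil.
rewrite addrC; apply: plpath_cat IH _.
by rewrite cdistC -[cdist b a]addr0; apply: plpath_cons; exact: plpath_nil.
Qed.

Lemma dballP X (x : pt X) e y :
  dball x e y <-> exists2 l, plpath x y l & l < e.
Proof.
split.
  by move=> /ereal_inf_lt[_ [l xyl <-]]; rewrite lte_fin => le; exists l.
move=> [l xyl le]; rewrite /dball (@le_lt_trans _ _ l%:E) ?lte_fin //.
by apply: ereal_inf_lbound; exists l.
Qed.

Lemma dball_center X (x : pt X) (e : R) : 0 < e -> dball x e x.
Proof. by move=> e0; apply/dballP; exists 0 => //; exact: plpath_nil. Qed.

Lemma dball_sym X (x y : pt X) (e : R) : dball x e y -> dball y e x.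
Proof.
by move/dballP => [l /plpath_rev yxl le]; apply/dballP; exists l.
Qed.

Lemma dball_triangle X (x y z : pt X) (e1 e2 : R) :
  dball x e1 y -> dball y e2 z -> dball x (e1 + e2) z.
Proof.
move=> /dballP[k xyk ke] /dballP[l yzl le]; apply/dballP.
by exists (k + l); [exact: plpath_cat xyk yzl | exact: ltrD].
Qed.

(* The points of a complex carry the topology of the path metric. *)
HB.instance Definition _ X := gen_eqMixin (pt X).
HB.instance Definition _ X := gen_choiceMixin (pt X).
HB.instance Definition _ X :=
  hasNbhs.Build (pt X) (nbhs_ (entourage_ (@dball X))).
HB.instance Definition _ X := @Nbhs_isPseudoMetric.Build R (pt X)
  (entourage_ (@dball X)) erefl (@dball X)
  (@dball_center X) (@dball_sym X) (@dball_triangle X) erefl.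

Definition geodesic X (x y : pt X) (l : R) (c : R -> pt X) :=
  [/\ 0 <= l, c 0 = x, c l = y &
      forall s t, 0 <= s <= l -> 0 <= t <= l ->
        dist (c s) (c t) = `|s - t|%:E].

(* [dist] is a nonempty geodesic metric space (its symmetry and the triangle
   inequality hold by construction) in which no geodesic triangle is fatter
   than a comparison triangle p' q' r' in the Euclidean plane.  As p, q, r are
   arbitrary, it is enough to compare points of the two sides issued from p. *)
Definition CAT0 X :=
  [/\ exists x : pt X, True,
      forall x y : pt X, dist x y = 0%E -> x = y,
      forall x y : pt X, exists l c, geodesic x y l c &
      forall (p q r : pt X) (lpq lpr lqr : R) (cpq cpr cqr : R -> pt X),
        geodesic p q lpq cpq -> geodesic p r lpr cpr -> geodesic q r lqr cqr ->
        forall p' q' r' : 'rV[R]_2,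
          euclid p' q' = lpq -> euclid p' r' = lpr -> euclid q' r' = lqr ->
        forall s t : R, 0 <= s <= 1 -> 0 <= t <= 1 ->
          (dist (cpq (s * lpq)%R) (cpr (t * lpr)%R) <=
           (euclid (p' + s *: (q' - p')) (p' + t *: (r' - p')))%R%:E)%E].

Definition opposite_edges X (e e' : cell X) :=
  exists (s : cell X) (i : 'I_(cdim s)),
    [/\ cdim s = 2%N, face_of (facet i false) e & face_of (facet i true) e'].

Definition hyperplane X (H : set (cell X)) :=
  exists e, cdim e = 1%N /\
    H = [set e' | clos_refl_sym_trans _ (@opposite_edges X) e e'].

(* The union of the midcubes dual to the edges in H: the midcube of c
   orthogonal to the i-th direction belongs to it when an edge of c parallel
   to that direction is in H. *)
Definition midcubes X (H : set (cell X)) : set (pt X) :=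
  [set x | exists (c : cell X) (i : 'I_(cdim c)) (a : cube R (cdim c)),
     [/\ x = chart c a, ccoord a i = 2^-1 &
       exists (F : face (cdim c)) (e : cell X),
         [/\ forall j, F j = None <-> j = i, face_of F e & H e]]].

Definition separates X (H : set (cell X)) (x y : pt X) :=
  [/\ ~ midcubes H x, ~ midcubes H y &
      ~ connected_component (~` midcubes H) x y].

(* The complement of the hyperplane has two components, those of x and of y,
   and h is the closure of the former.  By a theorem of Sageev every
   hyperplane of a CAT(0) cube complex has two components in this sense. *)
Definition halfspace X (H : set (cell X)) (h : set (pt X)) :=
  exists x y, [/\ separates H x y,
    ~` midcubes H = connected_component (~` midcubes H) x `|`
                    connected_component (~` midcubes H) y &
    h = closure (connected_component (~` midcubes H) x)].

Definition diametrically_opposed X (v vs : cell X) :=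
  forall H, hyperplane H -> separates H (vpt v) (vpt vs).

Definition cubical X (f : pt X -> pt X) :=
  forall c : cell X, exists (c' : cell X)
    (g : cube R (cdim c) -> cube R (cdim c')),
    [/\ cube_isometry g, range g = setT &
        forall a, f (chart c a) = chart c' (g a)].

Definition automorphism X (f : pt X -> pt X) :=
  exists f', [/\ cancel f f', cancel f' f, cubical f & cubical f'].

Definition subcomplex X (A : set (cell X)) :=
  forall c (F : face (cdim c)) c', A c -> face_of F c' -> A c'.

Definition carrier X (A : set (cell X)) : set (pt X) :=
  [set x | exists c a, A c /\ x = chart c a].

Section Action.
Variables (G : groupType) (X : complex R) (act : G -> pt X -> pt X).

Definition cubical_action :=
  [/\ forall x, act 1%g x = x,
      forall g h x, act (g * h)%g x = act g (act h x) &
      forall g, automorphism (act g)].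

Definition cocompact :=
  exists A : set (cell X), [/\ subcomplex A, compact (carrier A) &
    forall x, exists g, exists2 y, carrier A y & x = act g y].

Definition essential :=
  forall H h, hyperplane H -> halfspace H h ->
  forall (x : cell X), is_vertex x ->
  forall r : R, exists g, h (act g (vpt x)) /\
    forall z, midcubes H z -> (r%:E <= dist (act g (vpt x)) z)%E.

End Action.

End CubeComplex.

Section Groups.

Definition isomorphic (G H : groupType) :=
  exists f : G -> H, bijective f /\ {morph f : x y / (x * y)%g >-> (x * y)%g}.

Definition subgroup (G : groupType) (H : set G) :=
  H 1%g /\ forall x y, H x -> H y -> H (x * y^-1)%g.

Definition gen_subgroup (G : groupType) (S : set G) : set G :=
  \bigcap_(H in [set H | subgroup H /\ S `<=` H]) H.

Fixpoint derived_series (G : groupType) (H : set G) (n : nat) : set G :=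
  if n is k.+1 then
    gen_subgroup
      [set commg x y | x in derived_series H k & y in derived_series H k]
  else H.

Definition solvable_subgroup (G : groupType) (H : set G) :=
  exists n, derived_series H n `<=` [set 1%g].

Definition solvable_group (G : groupType) := solvable_subgroup [set: G].

Definition finite_index (G : groupType) (H : set G) :=
  exists s : seq G, forall g, exists2 t, t \in s & H (t^-1 * g)%g.

Definition virtually_solvable (G : groupType) :=
  exists H : set G, [/\ subgroup H, finite_index H & solvable_subgroup H].

(* Words in an alphabet T and its formal inverses, (x, true) standing for
   x^-1.  The nonempty reduced words are the nontrivial elements of the free
   group on T. *)
Definition reduced (T : eqType) (w : seq (T * bool)) : bool :=
  sorted (fun p q => ~~ ((p.1 == q.1) && (p.2 != q.2))) w.

Definition eval_word (T : Type) (G : groupType) (f : T -> G)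
    (w : seq (T * bool)) : G :=
  foldr (fun p g => (if p.2 then (f p.1)^-1 else f p.1) * g)%g 1%g w.

Definition satisfies_law (G : groupType) :=
  exists (r : nat) (w : seq ('I_r * bool)),
    [/\ w != [::], reduced w & forall f : 'I_r -> G, eval_word f w = 1%g].

Definition word_in (G : groupType) (S : seq G) (w : seq (G * bool)) : bool :=
  all (fun p => p.1 \in S) w.

Definition generates (G : groupType) (S : seq G) :=
  forall g : G, exists2 w, word_in S w & eval_word id w = g.

Definition finitely_generated (G : groupType) :=
  exists S : seq G, generates S.

(* The length of the shortest relation among the elements of S (+oo if there
   is none).  Words are reduced in the free group on S: the relation s s of an
   involution s counts, with length 2. *)
Definition girth_of (R : realType) (G : groupType) (S : seq G) : \bar R :=
  ereal_inf [set (size w)%:R%:E | w in [set w : seq (G * bool) |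
    [/\ w != [::], reduced w, word_in S w & eval_word id w = 1%g]]].

Definition girth (R : realType) (G : groupType) : \bar R :=
  ereal_sup [set girth_of R S | S in [set S : seq G | generates S]].

Definition girth_alternative (R : realType) (C : groupType -> Prop) :=
  forall G, C G -> virtually_solvable G \/ girth R G = +oo%E.

End Groups.

(* The class of finitely generated groups acting cocompactly on a finite
   dimensional CAT(0) cube complex. *)
Definition cocompactly_cubulated (R : realType) (G : groupType) :=
  finitely_generated G /\
  exists (X : complex R) (act : G -> pt X -> pt X),
    [/\ cube_complex X, CAT0 X, finite_dimensional X, cubical_action act
      & cocompact act].

(* The infinite cyclic group, written multiplicatively. *)
Definition Zgrp := int.
HB.instance Definition _ := Choice.on Zgrp.
HB.instance Definition _ := @isGroup.Build Zgrp (0 : int) -%R +%R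
  (@addrA int) (@add0r int) (@addr0 int) (@addNr int) (@addrN int).

Section DirectSum.
Variables (I : Type) (A : groupType).

Definition fin_support (f : I -> A) := finite_set [set i | f i <> 1%g].

Definition dsum := {f : I -> A | fin_support f}.

HB.instance Definition _ := gen_eqMixin dsum.
HB.instance Definition _ := gen_choiceMixin dsum.

Lemma dsum_eq (f g : dsum) : (forall i, sval f i = sval g i) -> f = g.
Proof. by case: f g => f ? [g ?] /= fg; apply: eq_exist; apply/funext. Qed.

Lemma dsum1_subproof : fin_support (fun=> 1%g).
Proof. by rewrite /fin_support (_ : [set _ | _] = set0) // -subset0 => i. Qed.

Lemma dsumM_subproof (f g : dsum) :
  fin_support (fun i => sval f i * sval g i)%g.
Proof.
case: f g => [f fP] [g gP] /=.
apply: (@sub_finite_set _ _ ([set i | f i <> 1%g] `|` [set i | g i <> 1%g])).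
  move=> i /= fg; have [fi|] := pselect (f i = 1%g); last by left.
  by right => gi; apply: fg; rewrite fi gi mulg1.
by rewrite finite_setU.
Qed.

Lemma dsumV_subproof (f : dsum) : fin_support (fun i => (sval f i)^-1)%g.
Proof.
case: f => [f fP] /=; apply: sub_finite_set fP => i /= fi f1.
by apply: fi; rewrite f1 invg1.
Qed.

Definition dsum1 : dsum := exist _ _ dsum1_subproof.
Definition dsumM f g : dsum := exist _ _ (dsumM_subproof f g).
Definition dsumV f : dsum := exist _ _ (dsumV_subproof f).

Lemma dsumMA : associative dsumM.
Proof. by move=> f g h; apply: dsum_eq => i /=; rewrite mulgA. Qed.
Lemma dsum1M : left_id dsum1 dsumM.
Proof. by move=> f; apply: dsum_eq => i /=; rewrite mul1g. Qed.
Lemma dsumM1 : right_id dsum1 dsumM.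
Proof. by move=> f; apply: dsum_eq => i /=; rewrite mulg1. Qed.
Lemma dsumVM : left_inverse dsum1 dsumV dsumM.
Proof. by move=> f; apply: dsum_eq => i /=; rewrite mulVg. Qed.
Lemma dsumMV : right_inverse dsum1 dsumV dsumM.
Proof. by move=> f; apply: dsum_eq => i /=; rewrite mulgV. Qed.

HB.instance Definition _ :=
  isGroup.Build dsum dsumMA dsum1M dsumM1 dsumVM dsumMV.

(* Reindexing along a bijection of I. *)
Lemma reindex_subproof (s s' : I -> I) (f : dsum) :
  cancel s s' -> fin_support (fun i => sval f (s i)).
Proof.
move=> sK; case: f => [f fP] /=.
apply: sub_finite_set (finite_image s' fP) => i /= fi.
by exists (s i).
Qed.

End DirectSum.

(* An action of the group H on the group N by automorphisms. *)
Record aut_action (H N : groupType) := AutAction {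
  aact :> H -> N -> N;
  aactMr : forall h, {morph aact h : x y / (x * y)%g >-> (x * y)%g};
  aact1 : forall x, aact 1%g x = x;
  aactM : forall h k x, aact (h * k)%g x = aact h (aact k x)
}.

(* The semidirect product of H and N, with product
   (n, h) (n', h') = (n (h n'), h h'). *)
Record sdprod (H N : groupType) (phi : aut_action H N) := SDPair {
  sdN : N;
  sdH : H
}.
Arguments SDPair {H N} phi _ _.

Section SemidirectProduct.
Variables (H N : groupType) (phi : aut_action H N).
Local Open Scope group_scope.

HB.instance Definition _ := gen_eqMixin (sdprod phi).
HB.instance Definition _ := gen_choiceMixin (sdprod phi).

Definition sd1 := SDPair phi 1 1.
Definition sdM (x y : sdprod phi) :=
  SDPair phi (sdN x * phi (sdH x) (sdN y)) (sdH x * sdH y).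
Definition sdV (x : sdprod phi) :=
  SDPair phi (phi (sdH x)^-1 (sdN x)^-1) (sdH x)^-1.

Lemma aact_1r h : phi h 1 = 1.
Proof. by apply: (mulgI (phi h 1)); rewrite -aactMr !mulg1. Qed.

Lemma sdMA : associative sdM.
Proof.
by move=> x y z; rewrite /sdM /= aactMr aactM !mulgA.
Qed.
Lemma sd1M : left_id sd1 sdM.
Proof. by move=> [n h]; rewrite /sdM /= aact1 !mul1g. Qed.
Lemma sdM1 : right_id sd1 sdM.
Proof. by move=> [n h]; rewrite /sdM /= aact_1r !mulg1. Qed.
Lemma sdVM : left_inverse sd1 sdV sdM.
Proof. by move=> [n h]; rewrite /sdM /= -aactMr !mulVg aact_1r. Qed.
Lemma sdMV : right_inverse sd1 sdV sdM.
Proof. by move=> [n h]; rewrite /sdM /= -aactM !mulgV aact1 mulgV. Qed.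

HB.instance Definition _ := isGroup.Build (sdprod phi) sdMA sd1M sdM1 sdVM sdMV.

End SemidirectProduct.

Section RestrictedWreath.
Variables (A B : groupType).
Local Open Scope group_scope.

Definition translate (b : B) (f : dsum B A) : dsum B A :=
  exist _ (fun x => sval f (b^-1 * x)) (reindex_subproof f (mulKg b^-1)).

Lemma translateMr b :
  {morph translate b : f g / f * g >-> f * g}.
Proof. by move=> f g; apply: dsum_eq. Qed.
Lemma translate1 f : translate 1 f = f.
Proof. by apply: dsum_eq => x /=; rewrite invg1 mul1g. Qed.
Lemma translateM b c f : translate (b * c) f = translate b (translate c f).
Proof. by apply: dsum_eq => x /=; rewrite invgM mulgA. Qed.

Definition wreath := sdprod (AutAction translateMr translate1 translateM).
HB.instance Definition _ := Group.on wreath.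

End RestrictedWreath.

Section Shift.
Variable A : groupType.

Lemma shiftK (k : int) : cancel (fun i => i - k) (fun i => i + k).
Proof. by move=> i; rewrite subrK. Qed.

Definition dshift (k : Zgrp) (f : dsum int A) : dsum int A :=
  exist _ (fun i => sval f (i - k)) (reindex_subproof f (shiftK k)).

Lemma shiftMr k : {morph dshift k : f g / (f * g)%g >-> (f * g)%g}.
Proof. by move=> f g; apply: dsum_eq. Qed.
Lemma shift1 f : dshift 1%g f = f.
Proof. by apply: dsum_eq => x /=; rewrite subr0. Qed.
Lemma shiftM k l f : dshift (k * l)%g f = dshift k (dshift l f).
Proof. by apply: dsum_eq => x /=; rewrite opprD addrA. Qed.

Definition shift_action := AutAction shiftMr shift1 shiftM.

End Shift.

Section Automorphisms.
Context {R : realType} {X : complex R}.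
Variables v vs : cell X.

Lemma cubical_comp (f g : pt X -> pt X) :
  cubical f -> cubical g -> cubical (f \o g).
Proof.
move=> fC gC c; have [c1 [g1 [g1i g1s g1E]]] := gC c.
have [c2 [g2 [g2i g2s g2E]]] := fC c1; exists c2, (g2 \o g1); split.
- by move=> a b; rewrite /= g2i g1i.
- apply/seteqP; split=> // y _; have [x _ <-] : range g2 y by rewrite g2s.
  by have [z _ <-] : range g1 x; [rewrite g1s | exists z].
- by move=> a; rewrite /= g1E g2E.
Qed.

Lemma cubical_id : cubical (@id (pt X)).
Proof. by move=> c; exists c, id; split=> //; exact: image_id. Qed.

Definition fixing_aut (f : pt X -> pt X) :=
  [/\ automorphism f, f (vpt v) = vpt v & f (vpt vs) = vpt vs].

Lemma fixing_id : fixing_aut id.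
Proof. by split=> //; exists id; split=> //; exact: cubical_id. Qed.

Lemma fixing_comp f g : fixing_aut f -> fixing_aut g -> fixing_aut (f \o g).
Proof.
move=> [[f' [fK f'K fC f'C]] fv fvs] [[g' [gK g'K gC g'C]] gv gvs].
split; rewrite /= ?gv ?gvs //; exists (g' \o f').
by split; [exact: can_comp | exact: can_comp | exact: cubical_comp
  | exact: cubical_comp].
Qed.

Lemma fixing_inv f : fixing_aut f ->
  exists f', [/\ cancel f f', cancel f' f & fixing_aut f'].
Proof.
move=> [[f' [fK f'K fC f'C]] fv fvs]; exists f'; split=> //.
split; last 2 first.
- by rewrite -{1}fv fK.
- by rewrite -{1}fvs fK.
by exists f; split.
Qed.

Definition FixAut := {f : pt X -> pt X | fixing_aut f}.

HB.instance Definition _ := gen_eqMixin FixAut.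
HB.instance Definition _ := gen_choiceMixin FixAut.

Lemma Aut_eq (f g : FixAut) : sval f =1 sval g -> f = g.
Proof. by case: f g => f ? [g ?] /= fg; apply: eq_exist; apply/funext. Qed.

Definition aut1 : FixAut := exist _ _ fixing_id.
Definition autM (f g : FixAut) : FixAut :=
  exist _ _ (fixing_comp (svalP f) (svalP g)).
Definition autV_fun (f : FixAut) := cid (fixing_inv (svalP f)).
Lemma autV_subproof f : fixing_aut (sval (autV_fun f)).
Proof. by case: (autV_fun f) => f' []. Qed.
Definition autV (f : FixAut) : FixAut := exist _ _ (autV_subproof f).

Lemma autMA : associative autM.
Proof. by move=> f g h; apply: Aut_eq. Qed.
Lemma aut1M : left_id aut1 autM.
Proof. by move=> f; apply: Aut_eq. Qed.
Lemma autM1 : right_id aut1 autM.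
Proof. by move=> f; apply: Aut_eq. Qed.
Lemma autVM : left_inverse aut1 autV autM.
Proof.
by move=> f; apply: Aut_eq => x /=; case: (autV_fun f) => f' [] /= ->.
Qed.
Lemma autMV : right_inverse aut1 autV autM.
Proof.
by move=> f; apply: Aut_eq => x /=; case: (autV_fun f) => f' [] /= _ ->.
Qed.

HB.instance Definition _ := isGroup.Build FixAut autMA aut1M autM1 autVM autMV.

End Automorphisms.
Arguments FixAut {R X} v vs.

Section Quotient.
Variables (T : Type) (r : T -> T -> Prop).

(* The quotient of T by the equivalence relation generated by r. *)
Definition quot :=
  {S : set T | exists x, S = [set y | clos_refl_sym_trans T r x y]}.

Definition cls (x : T) : quot := exist _ _ (ex_intro _ x erefl).

Definition rep (q : quot) : T := sval (cid (svalP q)).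

End Quotient.

(* (i, b) is identified with (i + 1, a). *)
Definition glue_rel (T : Type) (a b : T) (p q : int * T) :=
  [/\ p.2 = b, q.2 = a & q.1 = p.1 + 1].

Section Line.
Context {R : realType} {X : complex R}.
Variables v vs : cell X.

Definition line_pt := quot (glue_rel (vpt v) (vpt vs)).
Definition line_cell := quot (glue_rel v vs).
Definition line_dim (q : line_cell) : nat := cdim (rep q).2.
Definition line_chart (q : line_cell) (a : cube R (line_dim q)) : line_pt :=
  cls _ ((rep q).1, chart (rep q).2 a).

(* The complex L[X] when v and vs are vertices; [cls _ (i, x)] is the copy of x
   in X_i. *)
Definition line : complex R := Complex line_chart.

Definition Sigma := dsum int (FixAut v vs).
HB.instance Definition _ := Group.on Sigma.

Definition ZSigma := sdprod (shift_action (FixAut v vs)).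
HB.instance Definition _ := Group.on ZSigma.

Definition shift_pt (k : int) (q : pt line) : pt line :=
  cls _ ((rep q).1 + k, (rep q).2).

Definition Sigma_pt (s : Sigma) (q : pt line) : pt line :=
  cls _ ((rep q).1, sval (sval s (rep q).1) (rep q).2).

Definition line_act (g : ZSigma) (q : pt line) : pt line :=
  Sigma_pt (sdN g) (shift_pt (sdH g) q).

End Line.

Section StandardCube.
Context {R : realType}.
Variable m : nat.

Definition face_dim (F : face m) : nat := #|[pred i | F i == None]|.

Definition face_coord (F : face m) (a : cube R (face_dim F)) (i : 'I_m) : R :=
  if F i is Some b then b%:R
  else \sum_(j < face_dim F | enum_val j == i) ccoord a j.

Lemma face_coord_itv F (a : cube R (face_dim F)) i :
  0 <= face_coord a i <= 1.
Proof.
rewrite /face_coord; case: (F i) => [[]|]; rewrite ?lexx ?ler01 //.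
have [j ji|] := pickP (fun j : 'I_(face_dim F) => enum_val j == i).
  rewrite (big_pred1 j) ?ccoord_itv // => k /=.
  by rewrite -(eqP ji) (inj_eq enum_val_inj).
by move=> none; rewrite big_pred0 // lexx ler01.
Qed.

Definition face_chart (F : face m) (a : cube R (face_dim F)) : cube R m :=
  mkcube (face_coord_itv a).

(* [0,1]^m, with its faces as cells; the characteristic map of a face lists
   its free coordinates in increasing order. *)
Definition std_cube : complex R := Complex face_chart.

Definition corner (b : bool) : cell std_cube := [ffun => Some b].

End StandardCube.
Arguments std_cube R m : clear implicits.
Arguments corner {R} m b.

(* Main.v *)
(* A path from one side of a gluing vertex of L[X] to the other runs through
   that vertex, and gluing two spaces at a point preserves the inequality of
   Bruhat and Tits, which characterises CAT(0) among geodesic spaces: hence L[X]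
   is CAT(0). A hyperplane of L[X] lives in a single copy of X and separates the
   two gluing vertices of that copy, so each of its halfspaces contains all the
   copies to the left or all the copies to the right, and large translations are
   deep in it.
   Barycenters of distinct cells are at distance at least 1/2; so a compact X has
   finitely many cells, and A = Aut_{v,v*}(X) is finite, of some exponent N. As
   commutators of the wreath product lie in the base group, [x, y]^N is a law;
   evaluated at two distinct generators it bounds the girth by 4N. For a subgroup
   H of finite index, some coordinate of the base group is such that the elements
   of H in the base group project onto A there, so H is not solvable. *)

Require Import Defs.
From mathcomp Require Import all_boot all_order all_algebra all_fingroup.
From mathcomp Require nilpotent alt.
From mathcomp Require Import all_classical all_reals all_analysis.
From mathcomp Require Import zify ring lra.
From Stdlib Require Import Relation_Operators.

Set Implicit Arguments.
Unset Strict Implicit.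
Unset Printing Implicit Defensive.

Import Order.TTheory GRing.Theory Num.Theory.

(** * Euclidean geometry of cubes *)

Section EuclideanGeometry.
Context {R : realType}.
Local Open Scope ring_scope.

(** Two obstacles shape the proof. The vertices [v] and [vs] are not assumed distinct, while every
    cut argument needs it: if they carried the same point, all copies would be glued at that one
    point. Distinctness has to be drawn from non-solvability ([opposed_distinct]). Moreover, points
    and cells of L[X] are classes, and charts and actions are computed on chosen representatives.
    Only gluing vertices have several representatives, so statements pass between L[X] and a copy of
    X through cells of positive dimension, whose representative is unique, or through the retraction
    onto a copy, which does not lengthen paths. The Bruhat-Tits inequality is preferred to the
    comparison of triangles because it involves four points at a time and can be stated on a subset:
    four points lie in finitely many consecutive copies, and these are added one by one, each glued
    at a single point. *)

Definition sqd n (a b : 'rV[R]_n) : R := \sum_i (a ord0 i - b ord0 i) ^+ 2.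

Lemma sqd_ge0 n (a b : 'rV[R]_n) : 0 <= sqd a b.
Proof. by apply: sumr_ge0 => i _; exact: sqr_ge0. Qed.

Lemma euclid_ge0 n (a b : 'rV[R]_n) : 0 <= euclid a b.
Proof. exact: sqrtr_ge0. Qed.

Lemma euclid_sq n (a b : 'rV[R]_n) : euclid a b ^+ 2 = sqd a b.
Proof. by rewrite sqr_sqrtr ?sqd_ge0. Qed.

Lemma sqd_eq0 n (a b : 'rV[R]_n) : sqd a b = 0 -> a = b.
Proof.
move/eqP; rewrite psumr_eq0 => [/allP ab|i _]; last exact: sqr_ge0.
apply/rowP => i; have := ab i (mem_index_enum _).
by rewrite -(ord1 ord0) /= sqrf_eq0 subr_eq0 => /eqP.
Qed.

Lemma sqdC n (a b : 'rV[R]_n) : sqd a b = sqd b a.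
Proof. by apply: eq_bigr => i _; rewrite -sqrrN opprB. Qed.

Lemma euclid_eq0 n (a b : 'rV[R]_n) : euclid a b = 0 -> a = b.
Proof. by move=> ab; apply: sqd_eq0; rewrite -euclid_sq ab expr0n. Qed.

Lemma euclidC n (a b : 'rV[R]_n) : euclid a b = euclid b a.
Proof. by rewrite /euclid -/(sqd a b) sqdC. Qed.

(* Stewart's theorem. *)
Lemma sqd_segment n (p q r : 'rV[R]_n) (t : R) :
  sqd p (q + t *: (r - q)) =
  (1 - t) * sqd p q + t * sqd p r - t * (1 - t) * sqd q r.
Proof.
rewrite /sqd !mulr_sumr -sumrN -!big_split /=; apply: eq_bigr => i _.
by rewrite !mxE; ring.
Qed.

(** The law of cosines turns the scalar product of the two sides into lengths, so the comparison
    distance of CAT(0) is a polynomial in the side lengths. *)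
Lemma sqd_two_sides n (p q r : 'rV[R]_n) (s t : R) :
  sqd (p + s *: (q - p)) (p + t *: (r - p)) =
  s ^+ 2 * sqd p q + t ^+ 2 * sqd p r + t * s * (sqd q r - sqd p q - sqd p r).
Proof.
rewrite /sqd -!sumrN -!big_split /= !mulr_sumr -!big_split /=.
by apply: eq_bigr => i _; rewrite !mxE; ring.
Qed.

Lemma euclid_triangle n (a b c : 'rV[R]_n) :
  euclid a c <= euclid a b + euclid b c.
Proof.
have [ab0|ab0] := eqVneq (euclid a b) 0.
  by rewrite ab0 (euclid_eq0 ab0) add0r.
have [bc0|bc0] := eqVneq (euclid b c) 0.
  by rewrite bc0 (euclid_eq0 bc0) addr0.
have u0 : 0 < euclid a b by rewrite lt_def ab0 euclid_ge0.
have w0 : 0 < euclid b c by rewrite lt_def bc0 euclid_ge0.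
set u := euclid a b in u0 *; set w := euclid b c in w0 *.
rewrite -(@ler_pXn2r _ 2) ?nnegrE ?addr_ge0 ?euclid_ge0 //.
(* The point of [a, c] dividing it in the ratio u : w is at distance at least
   0 from b. *)
have := sqd_ge0 b (a + (u / (u + w)) *: (c - a)).
rewrite sqd_segment (sqdC b a) -!euclid_sq -/u -/w.
set y := euclid a c; have uw : u + w != 0 by rewrite gt_eqF ?addr_gt0.
rewrite [X in 0 <= X](_ : _ = (u * w / (u + w) ^+ 2) * ((u + w) ^+ 2 - y ^+ 2)).
  have k0 : 0 < u * w / (u + w) ^+ 2.
    by rewrite divr_gt0 ?mulr_gt0 ?exprn_gt0 ?addr_gt0.
  by rewrite pmulr_rge0 // subr_ge0.
by field.
Qed.

(** Stewart's theorem makes the squared distance from [x] to the candidate point vanish. *)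
Lemma segment_unique n (p q x : 'rV[R]_n) (t : R) : 
  sqd p x = t ^+ 2 * sqd p q -> sqd x q = (1 - t) ^+ 2 * sqd p q ->
  x = p + t *: (q - p).
Proof.
move=> px xq; apply: sqd_eq0; rewrite sqd_segment (sqdC x p) px xq; ring.
Qed.

Lemma euclid2 (a b c d : R) :
  sqd (\row_(i < 2) [:: a; b]`_i) (\row_(i < 2) [:: c; d]`_i) =
  (a - c) ^+ 2 + (b - d) ^+ 2.
Proof. by rewrite /sqd !big_ord_recl big_ord0 !mxE /= addr0. Qed.

Lemma comparison_triangle (a b c : R) :
  0 <= a -> 0 <= b -> 0 <= c -> a <= b + c -> b <= a + c -> c <= a + b ->
  exists p q r : 'rV[R]_2, [/\ euclid p q = a, euclid p r = b & euclid q r = c].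
Proof.
move=> a0 b0 c0 abc bac cab.
have euE (x y : 'rV[R]_2) l : 0 <= l -> sqd x y = l ^+ 2 -> euclid x y = l.
  by move=> l0; rewrite /euclid -/(sqd x y) => ->; rewrite sqrtr_sqr ger0_norm.
have [az|an] := eqVneq a 0.
  have bc : c = b by apply/eqP; rewrite eq_le; lra.
  exists (\row_(i < 2) [:: 0; 0]`_i), (\row_(i < 2) [:: 0; 0]`_i),
    (\row_(i < 2) [:: b; 0]`_i).
  by split; apply: euE => //; rewrite euclid2 ?az ?bc; ring.
have ap : 0 < a by rewrite lt_def an.
(* By the law of cosines, the abscissa of [r] when [p] is the origin and [q] is at (a, 0). *)
pose x := (a ^+ 2 + b ^+ 2 - c ^+ 2) / (2 * a).
have xE : 2 * a * x = a ^+ 2 + b ^+ 2 - c ^+ 2 by rewrite /x; field.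
have y0 : 0 <= b ^+ 2 - x ^+ 2.
  have : 0 <= (2 * a * b) ^+ 2 - (2 * a * x) ^+ 2.
    (* Heron's factorisation: the triangle inequalities make every factor nonnegative. *)
    rewrite xE (_ : _ - _ =
      ((c - a + b) * (c + a - b)) * ((a + b - c) * (a + b + c))); last by ring.
    by do ! apply: mulr_ge0; lra.
  rewrite (_ : _ - _ = (2 * a) ^+ 2 * (b ^+ 2 - x ^+ 2)); last by ring.
  by rewrite pmulr_rge0 // exprn_gt0 // mulr_gt0.
exists (\row_(i < 2) [:: 0; 0]`_i), (\row_(i < 2) [:: a; 0]`_i),
  (\row_(i < 2) [:: x; Num.sqrt (b ^+ 2 - x ^+ 2)]`_i).
split; apply: euE => //; rewrite euclid2.
- by ring.
- by rewrite !sub0r !sqrrN sqr_sqrtr //; ring.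
rewrite sub0r sqrrN sqr_sqrtr //.
rewrite (_ : _ + _ = a ^+ 2 + b ^+ 2 - 2 * a * x); last by ring.
by rewrite xE; ring.
Qed.

End EuclideanGeometry.

(** * Distances and midpoints in a cube *)

Section Cubes.
Context {R : realType}.
Local Open Scope ring_scope.
Local Open Scope classical_set_scope.
Implicit Types n m : nat.

Lemma cube_eq n (a b : cube R n) : (forall i, ccoord a i = ccoord b i) -> a = b.
Proof. by move=> ab; apply: val_inj; apply/rowP. Qed.

Lemma cube0_eq n (a b : cube R n) : n = 0%N -> a = b.
Proof. by move=> n0; apply: cube_eq => -[i ilt]; exfalso; rewrite n0 in ilt. Qed.

Lemma ccoordE n (f : 'I_n -> R) (fP : forall i, 0 <= f i <= 1) i :
  ccoord (mkcube fP) i = f i.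
Proof. by rewrite /ccoord mxE. Qed.

Lemma cdist_sq n (a b : cube R n) :
  cdist a b ^+ 2 = \sum_i (ccoord a i - ccoord b i) ^+ 2.
Proof. exact: euclid_sq. Qed.

Lemma cdist_ge0 n (a b : cube R n) : 0 <= cdist a b.
Proof. exact: euclid_ge0. Qed.

Lemma cdist_triangle n (a b c : cube R n) : cdist a c <= cdist a b + cdist b c.
Proof. exact: euclid_triangle. Qed.

Lemma cdist_eq0 n (a b : cube R n) : cdist a b = 0 -> a = b.
Proof. by move/euclid_eq0/val_inj. Qed.

Lemma ccoord_cdist n (a b : cube R n) i :
  `|ccoord a i - ccoord b i| <= cdist a b.
Proof.
rewrite -(@ler_pXn2r _ 2) ?nnegrE ?normr_ge0 ?cdist_ge0 //.
rewrite cdist_sq real_normK ?num_real // (bigD1 i) //= lerDl.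
by apply: sumr_ge0 => j _; exact: sqr_ge0.
Qed.

Lemma cube_isometry_inj n m (g : cube R m -> cube R n) :
  cube_isometry g -> injective g.
Proof. by move=> gi a b gab; apply: cdist_eq0; rewrite -gi gab cdistxx. Qed.

Lemma mid_itv n (a b : cube R n) i : 0 <= (ccoord a i + ccoord b i) / 2 <= 1.
Proof. by have := ccoord_itv a i; have := ccoord_itv b i; lra. Qed.

Definition mid n (a b : cube R n) : cube R n := mkcube (mid_itv a b).

Lemma midE n (a b : cube R n) i :
  ccoord (mid a b) i = (ccoord a i + ccoord b i) / 2.
Proof. exact: ccoordE. Qed.

Lemma cdist_mid n (a b : cube R n) : cdist a (mid a b) = cdist a b / 2.
Proof.
apply/eqP; rewrite -(@eqrXn2 _ 2) ?divr_ge0 ?cdist_ge0 //; apply/eqP.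
rewrite exprMn !cdist_sq mulr_suml; apply: eq_bigr => i _.
by rewrite midE; field.
Qed.

Lemma mid_unique n (a b x : cube R n) :
  cdist a x = cdist a b / 2 -> cdist x b = cdist a b / 2 -> x = mid a b.
Proof.
move=> ax xb; apply: cube_eq => i; rewrite midE /ccoord.
rewrite (@segment_unique _ _ (val a) (val b) (val x) 2^-1).
- by rewrite !mxE; field.
- by rewrite -!euclid_sq -!/(cdist _ _) ax; field.
- by rewrite -!euclid_sq -!/(cdist _ _) xb; field.
Qed.

Lemma midC n (a b : cube R n) : mid a b = mid b a.
Proof. by apply: cube_eq => i; rewrite !midE addrC. Qed.

(** Midpoints are determined by the distances to the two ends; this fact replaces affinity of
    isometries in what follows. *)
Lemma isometry_mid n m (g : cube R m -> cube R n) a b :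
  cube_isometry g -> g (mid a b) = mid (g a) (g b).
Proof.
move=> gi; apply: mid_unique; rewrite !gi; first exact: cdist_mid.
by rewrite cdistC midC cdist_mid cdistC.
Qed.

End Cubes.

(** * The path metric and the CAT(0) inequality *)

Section PathMetric.
Context {R : realType} {X : complex R}.
Local Open Scope classical_set_scope.
Local Open Scope ring_scope.
Implicit Types x y z : pt X.

Lemma plpath_ge0 x y l : plpath x y l -> 0 <= l.
Proof. by elim=> // c a b y0 l0 _ l0ge; rewrite addr_ge0 ?cdist_ge0. Qed.

Lemma dist_ge0 x y : (0 <= dist x y)%E.
Proof.
by apply: le_ereal_inf_tmp => _ [l xyl <-]; rewrite lee_fin (plpath_ge0 xyl).
Qed.

Lemma dist_le x y l : plpath x y l -> (dist x y <= l%:E)%E.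
Proof. by move=> xyl; apply: ereal_inf_lbound; exists l. Qed.

Lemma distxx x : dist x x = 0%E.
Proof.
by apply/eqP; rewrite eq_le dist_ge0 andbT; apply: dist_le; exact: plpath_nil.
Qed.

Lemma distC x y : dist x y = dist y x.
Proof.
by congr ereal_inf; apply/seteqP; split=> _ [l /plpath_rev xyl <-]; exists l.
Qed.

Lemma dist_triangle x y z : (dist x z <= dist x y + dist y z)%E.
Proof.
have [yz|] := ltP (dist y z) +oo%E; last first.
  by rewrite leye_eq => /eqP ->; rewrite addey ?leey // gt_eqF //
    (lt_le_trans _ (dist_ge0 x y)).
have yzf : dist y z \is a fin_num by rewrite ge0_fin_numE ?dist_ge0.
rewrite -leeBlDr //; apply: le_ereal_inf_tmp => _ [k xyk <-].
rewrite leeBlDr // -leeBlDl //; apply: le_ereal_inf_tmp => _ [l yzl <-].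
by rewrite leeBlDl // -EFinD; apply: dist_le; exact: plpath_cat xyk yzl.
Qed.

Lemma chart_dist (c : cell X) (a b : cube R (cdim c)) :
  (dist (chart c a) (chart c b) <= (cdist a b)%:E)%E.
Proof.
apply: dist_le; rewrite -[cdist a b]addr0; apply: plpath_cons.
exact: plpath_nil.
Qed.

Lemma geodesic_dist x y l c : geodesic x y l c -> dist x y = l%:E.
Proof.
move=> [l0 <- <- cD]; rewrite cD ?lexx ?l0 //.
by rewrite sub0r normrN ger0_norm.
Qed.

Lemma geodesic_rev x y l c :
  geodesic x y l c -> geodesic y x l (fun s => c (l - s)).
Proof.
move=> [l0 cx cy cd]; split=> //; rewrite ?subr0 ?subrr // => s t sl tl.
by rewrite cd //; [rewrite -normrN; congr (`|_|%:E); ring|lra|lra].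
Qed.

Lemma geodesic_cat x y z k l c d : dist x z = (k + l)%:E ->
  geodesic x y k c -> geodesic y z l d ->
  geodesic x z (k + l) (fun s => if s <= k then c s else d (s - k)).
Proof.
move=> xz [k0 cx cy cD] [l0 dy dz dD].
have [xyk yzl] : dist x y = k%:E /\ dist y z = l%:E.
  by split; [apply: (@geodesic_dist _ _ _ c) | apply: (@geodesic_dist _ _ _ d)].
pose e s := if s <= k then c s else d (s - k).
have e_out s : k <= s -> e s = d (s - k).
  rewrite le_eqVlt /e => /orP[/eqP <-|ks]; first by rewrite lexx subrr cy dy.
  by rewrite leNgt ks.
have mono s t : 0 <= s -> s <= t -> t <= k + l -> dist (e s) (e t) = (t - s)%:E.
  move=> s0 st tkl; have [tk|kt] := leP t k.
    rewrite /e tk (le_trans st tk) cD; [|lra|lra].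
    by rewrite distrC ger0_norm ?subr_ge0.
  have [ks|sk] := leP k s.
    rewrite !e_out ?(ltW kt) // dD; [|lra|lra].
    by rewrite distrC ger0_norm; [congr (_%:E); ring | lra].
  rewrite (e_out t (ltW kt)) /e (ltW sk).
  have sy : dist (c s) y = (k - s)%:E.
    by rewrite -cy cD; [rewrite distrC ger0_norm //; lra | lra | lra].
  have yt : dist y (d (t - k)) = (t - k)%:E.
    by rewrite -dy dD; [rewrite sub0r normrN ger0_norm //; lra | lra | lra].
  have xs : dist x (c s) = s%:E.
    by rewrite -cx cD; [rewrite sub0r normrN ger0_norm //; lra | lra | lra].
  have tz : dist (d (t - k)) z = (k + l - t)%:E.
    rewrite -dz dD; [|lra|lra].
    by rewrite distrC ger0_norm; [congr (_%:E); ring | lra].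
  (* The upper bound goes through [y]. The lower bound comes from the chain [x], [c s], [d (t - k)],
     [z]: its ends are at distance [k + l], which leaves no slack. *)
  apply/eqP; rewrite eq_le; apply/andP; split.
    apply: le_trans (dist_triangle _ y _) _.
    by rewrite sy yt -EFinD lee_fin; lra.
  have := dist_triangle x (c s) z; rewrite xz xs.
  move/le_trans/(_ (leeD (lexx _) (dist_triangle _ (d (t - k)) _))).
  rewrite tz; case: (dist _ _) => [r||] //; rewrite ?leey //.
  by rewrite -!EFinD !lee_fin; lra.
split; first by rewrite addr_ge0.
- by rewrite k0.
- rewrite -/(e _) e_out ?lerDl //; rewrite -dz; congr d; ring.
move=> s t /andP[s0 skl] /andP[t0 tkl]; rewrite -!/(e _).
have [st|/ltW ts] := leP s t.
  by rewrite mono // distrC ger0_norm // subr_ge0.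
by rewrite distC mono // ger0_norm // subr_ge0.
Qed.

End PathMetric.

(** * The Bruhat-Tits inequality and gluing at a point *)

Section CNInequality.
Context {R : realType}.
Local Open Scope classical_set_scope.
Local Open Scope ring_scope.

(* The inequality of Bruhat and Tits for the points of S, where m is a point of
   a geodesic from q to r; multiplying it by the length of that geodesic avoids
   divisions. *)
Definition CN_on T (D : T -> T -> R) (S : set T) :=
  forall p q r m, S p -> S q -> S r -> S m -> D q m + D m r = D q r ->
    D q r * D p m ^+ 2 <=
      D m r * D p q ^+ 2 + D q m * D p r ^+ 2 - D q m * D m r * D q r.

(** Reduces a polynomial inequality to a known one with the same slack, the equality of the slacks
    being left to [ring]. *)
Lemma le_from_sub (a b c d : R) : c <= d -> b - a = d - c -> a <= b.
Proof. by rewrite -(subr_ge0 c) -(subr_ge0 a) => cd ->. Qed.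

Lemma sqr_diff_le (x y : R) : x <= y -> - y <= x -> x ^+ 2 <= y ^+ 2.
Proof.
move=> xy yx; have y0 : 0 <= y by lra.
rewrite -[x ^+ 2]real_normK ?num_real // ler_pXn2r ?nnegrE //.
by rewrite ler_norml yx.
Qed.

Section Wedge.
Variables (T : Type) (D : T -> T -> R).
Hypothesis D0 : forall x y, 0 <= D x y.
Hypothesis DC : forall x y, D x y = D y x.
Hypothesis DT : forall x y z, D x z <= D x y + D y z.

Section Side.
Variables (A B : set T) (z : T).
Hypothesis (Az : A z) (Bz : B z).
Hypothesis ABz : forall x y, A x -> B y -> D x y = D x z + D z y.
Hypothesis CNA : CN_on D A.

(** From A, the point [p] is seen through [z]: its distances are those of [z] increased by the
    constant g. The claim is the inequality for [z] plus 2g times the convexity of the distance to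
    [z]. *)
Lemma CN_wedge_out p q r m : B p -> A q -> A r -> A m ->
  D q m + D m r = D q r ->
  D q r * D p m ^+ 2 <=
    D m r * D p q ^+ 2 + D q m * D p r ^+ 2 - D q m * D m r * D q r.
Proof.
move=> Bp Aq Ar Am qmr; have := CNA Az Aq Ar Am qmr.
rewrite !(DC p) (ABz Aq Bp) (ABz Ar Bp) (ABz Am Bp).
rewrite (DC q z) (DC r z) (DC m z).
have dq0 := D0 z q; have dr0 := D0 z r; have dm0 := D0 z m.
have a0 := D0 q m; have b0 := D0 m r; have g0 := D0 z p.
have qr : (D z q - D z r) ^+ 2 <= D q r ^+ 2.
  apply: sqr_diff_le; last by have := DT z q r; lra.
  by have := DT z r q; rewrite (DC r q); lra.
move: qr dq0 dr0 dm0 a0 b0 g0; rewrite -qmr.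
set dq := D z q; set dr := D z r; set dm := D z m; set g := D z p.
set a := D q m; set b := D m r => qr dq0 dr0 dm0 a0 b0 g0 CN.
(* Convexity of the distance to [z], after squaring: the square of b dq + a dr is (a + b)(b dq^2 + a
   dr^2) - ab (dq - dr)^2, and dq - dr is at most a + b in absolute value. *)
have lin : (a + b) * dm <= b * dq + a * dr.
  rewrite -(@ler_pXn2r _ 2) ?nnegrE ?addr_ge0 ?mulr_ge0 ?addr_ge0 //.
  have ab0 := mulr_ge0 a0 b0; have l0 := addr_ge0 a0 b0.
  have := lerD (ler_wpM2l l0 CN) (ler_wpM2l ab0 qr) => /le_from_sub; apply.
  by ring.
have /(lerD CN)/le_from_sub := ler_wpM2l (mulr_ge0 (ler0n R 2) g0) lin; apply.
by ring.
Qed.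

(** The path from [q] to [r] passes through [z]. The inequality at [z] is combined with the one at
    [m], between [q] and [z], so that [D p z] cancels; for [p] in B the inequality at [z]
    suffices. *)
Lemma CN_wedge_cross p q r m : (A `|` B) p -> A q -> B r -> A m ->
  D q m + D m r = D q r ->
  D q r * D p m ^+ 2 <=
    D m r * D p q ^+ 2 + D q m * D p r ^+ 2 - D q m * D m r * D q r.
Proof.
move=> ABp Aq Br Am; rewrite (ABz Am Br) (ABz Aq Br) => qmr.
have {}qmr : D q m + D m z = D q z by lra.
have a0 := D0 q m; have e0 := D0 m z; have w0 := D0 z r; have z0 := D0 p z.
have m0 := D0 p m.
(* The inequality with [z] as intermediate point. According to the side of [p], it amounts to the
   triangle inequality between [p], [q], [z] or between [p], [r], [z]. *)
have kink : (D q z + D z r) * D p z ^+ 2 <= D z r * D p q ^+ 2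
    + D q z * D p r ^+ 2 - D q z * D z r * (D q z + D z r).
  case: ABp => [Ap|Bp].
    rewrite (ABz Ap Br); have : (D p z - D q z) ^+ 2 <= D p q ^+ 2.
      apply: sqr_diff_le; first by have := DT p q z; lra.
      by have := DT q p z; rewrite (DC q p); lra.
    by move/(ler_wpM2l w0)/le_from_sub; apply; ring.
  rewrite (DC p q) (ABz Aq Bp); have : (D p z - D z r) ^+ 2 <= D p r ^+ 2.
    apply: sqr_diff_le; first by have := DT p r z; rewrite (DC r z); lra.
    by have := DT z p r; rewrite (DC z p); lra.
  rewrite (DC z p); move/(ler_wpM2l (D0 q z))/le_from_sub; apply; ring.
(* The combination produces the claim multiplied by [D q z]; when this factor is 0, [m] is at
   distance 0 from [q]. *)
have [u0|u0] := eqVneq (D q z) 0.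
  have a00 : D q m = 0 by lra.
  have e00 : D m z = 0 by lra.
  rewrite u0 a00 e00 !add0r !mul0r subr0 addr0; apply: ler_wpM2l => //.
  rewrite ler_pXn2r ?nnegrE ?D0 //.
  by have := DT p q m; rewrite a00 addr0.
have up : 0 < D q z by rewrite lt_def u0 D0.
rewrite -(ler_pM2l up).
case: ABp => [Ap|Bp].
  have := CNA Ap Aq Az Am qmr.
  move/(ler_wpM2l (addr_ge0 (D0 q z) w0))/lerD/(_ (ler_wpM2l a0 kink)).
  by move/le_from_sub; apply; rewrite -qmr; ring.
move/(ler_wpM2l a0)/le_from_sub : kink; apply.
by rewrite !(DC p q) !(DC p m) (ABz Aq Bp) (ABz Am Bp) (DC z p) -qmr; ring.
Qed.

Lemma dist0_eq x m : D z m = 0 -> D x m = D x z.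
Proof.
move=> zm; apply/eqP; rewrite eq_le.
by have := DT x z m; have := DT x m z; rewrite (DC m) zm !addr0 => -> ->.
Qed.

(** A point [m] of B between two points of A would be a detour: D q m + D m r exceeds D q z + D z r
    by 2 D z m. Hence [D z m] is 0 and [z] can stand for [m]. *)
Lemma CN_wedge_same p q r m : (A `|` B) p -> A q -> A r -> (A `|` B) m ->
  D q m + D m r = D q r ->
  D q r * D p m ^+ 2 <=
    D m r * D p q ^+ 2 + D q m * D p r ^+ 2 - D q m * D m r * D q r.
Proof.
move=> ABp Aq Ar; have inA m' : A m' -> D q m' + D m' r = D q r ->
    D q r * D p m' ^+ 2 <=
    D m' r * D p q ^+ 2 + D q m' * D p r ^+ 2 - D q m' * D m' r * D q r.
  by move=> Am; case: ABp => [Ap|Bp]; [exact: CNA | exact: CN_wedge_out].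
case=> [Am|Bm]; first exact: inA.
move=> qmr; have zm : D z m = 0.
  have := DT q z r; have := D0 z m; move: qmr.
  by rewrite (DC m) (ABz Aq Bm) (ABz Ar Bm) (DC r z) => <-; lra.
have E x := dist0_eq x zm; move: qmr.
by rewrite (DC m r) !E (DC r z); exact: inA.
Qed.

End Side.

Lemma CN_wedge (A B : set T) (z : T) : A z -> B z ->
  (forall x y, A x -> B y -> D x y = D x z + D z y) ->
  CN_on D A -> CN_on D B -> CN_on D (A `|` B).
Proof.
move=> Az Bz ABz CNA CNB p q r m ABp.
have BAz x y : B x -> A y -> D x y = D x z + D z y.
  by move=> Bx Ay; rewrite DC (ABz _ _ Ay Bx) addrC (DC z x) (DC y z).
have BAp : (B `|` A) p by rewrite setUC.
case=> [Aq|Bq] [Ar|Br] ABm qmr.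
- exact: (CN_wedge_same Az ABz).
- case: (ABm) => [Am|Bm]; first exact: (CN_wedge_cross Az ABz).
  have rmq : D r m + D m q = D r q by rewrite addrC DC (DC r) qmr DC.
  have := CN_wedge_cross Bz BAz CNB BAp Br Aq Bm rmq.
  by rewrite (DC r q) (DC r m) (DC m q) => /le_from_sub; apply; ring.
- case: (ABm) => [Am|Bm]; last exact: (CN_wedge_cross Bz BAz).
  have rmq : D r m + D m q = D r q by rewrite addrC DC (DC r) qmr DC.
  have := CN_wedge_cross Az ABz CNA ABp Ar Bq Am rmq.
  by rewrite (DC r q) (DC r m) (DC m q) => /le_from_sub; apply; ring.
- by apply: (CN_wedge_same Bz BAz) => //; rewrite setUC.
Qed.

End Wedge.

End CNInequality.

(** * Equivalence of CAT(0) and the Bruhat-Tits inequality *)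

Section CAT0Characterization.
Context {R : realType} {X : complex R}.
Local Open Scope classical_set_scope.
Local Open Scope ring_scope.
Implicit Types x y z : pt X.

Definition rdist x y : R := fine (dist x y).

Lemma rdist_ge0 x y : 0 <= rdist x y.
Proof. by rewrite fine_ge0 // dist_ge0. Qed.

Lemma rdistC x y : rdist x y = rdist y x.
Proof. by rewrite /rdist distC. Qed.

Lemma geodesic_rdist x y l c : geodesic x y l c -> rdist x y = l.
Proof. by move/geodesic_dist; rewrite /rdist => ->. Qed.

Hypothesis geo : forall x y, exists l c, geodesic x y l c.

Lemma rdistE x y : dist x y = (rdist x y)%:E.
Proof. by have [l [c g]] := geo x y; rewrite /rdist (geodesic_dist g). Qed.

Lemma rdist_triangle x y z : rdist x z <= rdist x y + rdist y z.
Proof. by rewrite -lee_fin EFinD -!rdistE dist_triangle. Qed.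

Lemma geodesicP x y : exists c, geodesic x y (rdist x y) c.
Proof.
by have [l [c g]] := geo x y; exists c; rewrite (geodesic_rdist g).
Qed.

Let comparison := forall (p q r : pt X) (lpq lpr lqr : R)
  (cpq cpr cqr : R -> pt X),
  geodesic p q lpq cpq -> geodesic p r lpr cpr -> geodesic q r lqr cqr ->
  forall p' q' r' : 'rV[R]_2,
    euclid p' q' = lpq -> euclid p' r' = lpr -> euclid q' r' = lqr ->
  forall s t : R, 0 <= s <= 1 -> 0 <= t <= 1 ->
    (dist (cpq (s * lpq)%R) (cpr (t * lpr)%R) <=
     (euclid (p' + s *: (q' - p')) (p' + t *: (r' - p')))%R%:E)%E.

Lemma comparison_CN : comparison -> CN_on rdist [set: pt X].
Proof.
move=> cmp p q r m _ _ _ _ qmr.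
have [l0|l0] := eqVneq (rdist q r) 0.
  have := rdist_ge0 q m; have := rdist_ge0 m r => mr0 qm0.
  have -> : rdist q m = 0 by lra.
  have -> : rdist m r = 0 by lra.
  by rewrite l0 !mul0r; lra.
have lp : 0 < rdist q r by rewrite lt_def l0 rdist_ge0.
have [c1 g1] := geodesicP q m; have [c2 g2] := geodesicP m r.
have qr : dist q r = (rdist q m + rdist m r)%:E by rewrite rdistE qmr.
have g := geodesic_cat qr g1 g2; rewrite qmr in g.
set c := (fun s => _) in g.
have [d gd] := geodesicP q p; have [d' gd'] := geodesicP r p.
have [] := @comparison_triangle R (rdist q r) (rdist q p) (rdist r p);
  rewrite ?rdist_ge0 ?rdist_triangle //.
- by rewrite (rdistC r p) rdist_triangle.
- by rewrite (rdistC q r) rdist_triangle.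
move=> q' [r' [p' [qr' qp' rp']]].
pose t := rdist q m / rdist q r.
have t01 : 0 <= t <= 1.
  by rewrite divr_ge0 ?rdist_ge0 //= ler_pdivrMr // mul1r -qmr lerDl rdist_ge0.
have tl : t * rdist q r = rdist q m by rewrite /t divfK.
(* The comparison is applied from the vertex [q]: the point [m] of the side to [r] against the end
   [p] (parameter 1) of the other side. *)
have := cmp _ _ _ _ _ _ _ _ _ g gd gd' q' r' p' qr' qp' rp' t 1 t01.
rewrite ler01 lexx => /(_ isT); rewrite tl mul1r scale1r addrC.
have -> : c (rdist q m) = m by rewrite /c lexx; case: g1.
have -> : d (rdist q p) = p by case: gd.
rewrite (addrC q') subrK rdistE lee_fin rdistC.
rewrite -(@ler_pXn2r _ 2) ?nnegrE ?rdist_ge0 ?euclid_ge0 //.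
rewrite euclid_sq sqdC (addrC _ q') sqd_segment -!euclid_sq.
rewrite (euclidC p' q') (euclidC p') qp' rp' qr' !(rdistC p).
have mr : rdist m r = rdist q r - rdist q m by lra.
by move/(ler_wpM2l (ltW lp))/le_from_sub; apply; rewrite mr -tl; ring.
Qed.

(** The inequality is used twice: for the point of the side from p to q against the side from p to
    r, then for r against the side from p to q. Together the two bounds give exactly the planar
    value [sqd_two_sides]. *)
Lemma CN_comparison : CN_on rdist [set: pt X] -> comparison.
Proof.
move=> CN p q r lpq lpr lqr cpq cpr cqr gpq gpr gqr p' q' r' pq' pr' qr' s t
  s01 t01.
have cn x y w l c a : geodesic y w l c -> 0 <= a <= 1 ->
    rdist x (c (a * l)) ^+ 2 <=
    (1 - a) * rdist x y ^+ 2 + a * rdist x w ^+ 2 - a * (1 - a) * l ^+ 2.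
  move=> g a01; have yw := geodesic_rdist g; case: g => l0 cy cw cD.
  have [lz|ln] := eqVneq l 0.
    by move: cw; rewrite lz mulr0 cy => <-; lra.
  have lp : 0 < l by rewrite lt_def ln.
  have al0 : 0 <= a * l by rewrite mulr_ge0 //; lra.
  have all : a * l <= l by rewrite ler_piMl //; lra.
  have yc : rdist y (c (a * l)) = a * l.
    rewrite -cy /rdist cD ?lexx ?l0 ?al0 //=.
    by rewrite sub0r normrN ger0_norm.
  have cw' : rdist (c (a * l)) w = (1 - a) * l.
    by rewrite -cw /rdist cD ?lexx ?l0 ?al0 //= distrC ger0_norm; [ring | lra].
  have := @CN x y w (c (a * l)) I I I I; rewrite yc cw' yw => CNc.
  rewrite -(ler_pM2l lp); apply: le_from_sub (CNc _) _; ring.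
have [lpq0 lpr0] : 0 <= lpq /\ 0 <= lpr by case: gpq gpr => [? _ _ _] [].
rewrite rdistE lee_fin -(@ler_pXn2r _ 2) ?nnegrE ?rdist_ge0 ?euclid_ge0 //.
rewrite euclid_sq sqd_two_sides -!euclid_sq pq' pr' qr'.
have /andP[t0 t1] := t01.
apply: le_trans (cn _ _ _ _ _ _ gpr t01) _.
rewrite !(rdistC (cpq _)).
have pE : rdist p (cpq (s * lpq)) = s * lpq.
  case: gpq => _ pc _ cD; have /andP[s0 s1] := s01.
  rewrite -{1}pc /rdist cD ?lexx ?lpq0 ?mulr_ge0 ?ler_piMl //=.
  by rewrite sub0r normrN ger0_norm ?mulr_ge0.
have := cn r _ _ _ _ _ gpq s01.
rewrite pE (rdistC r p) (rdistC r q) (geodesic_rdist gpr) (geodesic_rdist gqr).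
by move/(ler_wpM2l t0)/le_from_sub; apply; ring.
Qed.

Lemma CAT0_criterion : (exists x : pt X, True) ->
  (forall x y, dist x y = 0%E -> x = y) -> CN_on rdist [set: pt X] -> CAT0 X.
Proof. by move=> ne sep /CN_comparison cmp; split. Qed.

End CAT0Characterization.

Lemma CAT0_CN (R : realType) (X : complex R) :
  CAT0 X -> CN_on (@rdist R X) [set: pt X].
Proof. by case=> _ _ geo cmp; exact: comparison_CN. Qed.

(** * Compact cube complexes are finite *)

Section CubeFaces.
Context {R : realType}.
Local Open Scope classical_set_scope.
Local Open Scope ring_scope.

Lemma upd_itv n (a : cube R n) (i : 'I_n) (x : R) (x01 : 0 <= x <= 1) j :
  0 <= (if j == i then x else ccoord a j) <= 1.
Proof. by case: ifP => // _; exact: ccoord_itv. Qed.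

Definition upd n (a : cube R n) (i : 'I_n) x (x01 : 0 <= x <= 1) : cube R n :=
  mkcube (upd_itv a i x01).

Lemma updE n (a : cube R n) (i : 'I_n) x (x01 : 0 <= x <= 1) j :
  ccoord (upd a i x01) j = if j == i then x else ccoord a j.
Proof. exact: ccoordE. Qed.

Lemma cdist_upd n (a : cube R n) (i : 'I_n) x (x01 : 0 <= x <= 1) :
  cdist (upd a i x01) a = `|x - ccoord a i|.
Proof.
apply/eqP; rewrite -(@eqrXn2 _ 2) ?normr_ge0 ?cdist_ge0 //; apply/eqP.
rewrite cdist_sq real_normK ?num_real // (bigD1 i) //= updE eqxx big1 ?addr0 //.
by move=> j /negPf ji; rewrite updE ji subrr expr0n.
Qed.

Lemma itv0 : 0 <= (0 : R) <= 1. Proof. by rewrite lexx ler01. Qed.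
Lemma itv1 : 0 <= (1 : R) <= 1. Proof. by rewrite lexx ler01. Qed.
Lemma itv_half : 0 <= (2^-1 : R) <= 1. Proof. lra. Qed.

Lemma in_face_upd n (F : face n) (a : cube R n) (i : 'I_n) x
  (x01 : 0 <= x <= 1) : F i = None -> in_face F a -> in_face F (upd a i x01).
Proof.
move=> Fi Fa j b Fj; rewrite updE; case: eqP => [ji|_]; last exact: Fa.
by rewrite ji Fi in Fj.
Qed.

(** The smallest face containing [a], which is therefore in its relative interior. *)
Definition support_face n (a : cube R n) : face n :=
  [ffun i => if ccoord a i == 0 then Some false
             else if ccoord a i == 1 then Some true else None].

Lemma in_support_face n (a : cube R n) : in_face (support_face a) a.
Proof.
by move=> i b; rewrite ffunE; case: eqP => [-> [<-]//|_]; case: eqP => [-> [<-]|].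
Qed.

Lemma support_faceN n (a : cube R n) i :
  support_face a i = None -> 0 < ccoord a i < 1.
Proof.
rewrite ffunE; have /andP[a0 a1] := ccoord_itv a i.
case: eqP => // /eqP na0; case: eqP => // /eqP na1 _.
by rewrite lt_def na0 a0 lt_def eq_sym na1 a1.
Qed.

Lemma support_face_margin n (a : cube R n) : exists2 e : R, 0 < e < 1 &
  forall i, support_face a i = None -> e <= ccoord a i <= 1 - e.
Proof.
pose f i := Num.min (ccoord a i) (1 - ccoord a i).
(* The initial value 2^-1 keeps the minimum strictly between 0 and 1, even when no coordinate is
   free. *)
exists (\big[Num.min/2^-1]_(i | support_face a i == None) f i).
  apply/andP; split; last by rewrite (le_lt_trans (bigmin_le_id _ _ _ _)) //; lra.
  apply: lt_bigmin => [|i /eqP/support_faceN /andP[i0 i1]]; first by lra.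
  by rewrite lt_min i0 subr_gt0.
move=> i /eqP iN.
have := @bigmin_le_cond _ _ _ 2^-1 i (fun i => support_face a i == None) f iN.
by rewrite {2}/f le_min => /andP[]; lra.
Qed.

Lemma isometry_interior m n (g : cube R m -> cube R n) (a : cube R m) :
  cube_isometry g -> range g = in_face (support_face (g a)) -> cube_interior a.
Proof.
move=> gi gF j; have [e /andP[e0 e1] he] := support_face_margin (g a).
(* a would otherwise be an endpoint of a short segment whose image could be
   prolonged within the face. *)
suff noext x (x01 : 0 <= x <= 1) : `|x - ccoord a j| <= e ->
    0 <= ccoord a j *+ 2 - x <= 1.
  have /andP[a0 a1] := ccoord_itv a j.
  (* Step by e / 2 away from the nearer end; the opposite point then still has its coordinate in
     [0, 1], so [a] is not at that end. *)
  have [lo|hi] := ltP (ccoord a j) 2^-1.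
    have x01 : 0 <= ccoord a j + e / 2 <= 1 by lra.
    have := noext _ x01; rewrite addrAC subrr add0r ger0_norm; last by lra.
    by move=> /(_ ltac:(lra)); lra.
  have x01 : 0 <= ccoord a j - e / 2 <= 1 by lra.
  have := noext _ x01; rewrite addrAC subrr add0r normrN ger0_norm; last by lra.
  by move=> /(_ ltac:(lra)); lra.
move=> xe; set b := g (upd a j x01).
have bF : in_face (support_face (g a)) b by rewrite -gF; exists (upd a j x01).
have ba i : `|ccoord b i - ccoord (g a) i| <= e.
  by apply: le_trans (ccoord_cdist _ _ _) _; rewrite /b gi cdist_upd.
(* Reflecting [b] through [g a] stays in the face: fixed coordinates agree, free ones have margin e.
   A preimage [c'] of the reflected point has [a] as its midpoint with the moved point. *)
have c01 i : 0 <= ccoord (g a) i *+ 2 - ccoord b i <= 1.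
  case E : (support_face (g a) i) => [t|].
    rewrite (bF _ _ E) (in_support_face E) mulr2n addrK.
    by case: (t); rewrite ?itv0 ?itv1.
  by have := he _ E; have := ba i; rewrite ler_norml; lra.
pose c := mkcube c01.
have [c' _ gc'] : range g c.
  rewrite gF => i t E; rewrite ccoordE (bF _ _ E) (in_support_face E).
  by rewrite mulr2n addrK.
have : g (mid (upd a j x01) c') = g a.
  rewrite isometry_mid // gc'; apply: cube_eq => i.
  by rewrite midE ccoordE -/b; field.
move/(cube_isometry_inj gi)/(congr1 (fun a => ccoord a j)).
rewrite midE updE eqxx => <-; have := ccoord_itv c' j.
by lra.
Qed.

Definition cube_center n : cube R n := mkcube (fun=> itv_half).

Lemma centerE n i : ccoord (cube_center n) i = 2^-1.
Proof. exact: ccoordE. Qed.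

Lemma center_interior n : cube_interior (cube_center n).
Proof. by move=> i; rewrite centerE; lra. Qed.

Lemma refl_itv n (a : cube R n) i : 0 <= 1 - ccoord a i <= 1.
Proof. by have := ccoord_itv a i; lra. Qed.

Definition reflect_cube n (a : cube R n) := mkcube (refl_itv a).

Lemma mid_reflect n (a : cube R n) : mid a (reflect_cube a) = cube_center n.
Proof. by apply: cube_eq => i; rewrite midE !ccoordE; field. Qed.

(** The centre is the midpoint of any point and its reflection. A point whose image has i-th
    coordinate 0 shows that the image of the centre has coordinate at most 1/2 there; one with
    coordinate 1 gives the reverse bound. *)
Lemma isometry_center m n (g : cube R m -> cube R n) (F : face n) i :
  cube_isometry g -> range g = in_face F -> F i = None ->
  ccoord (g (cube_center m)) i = 2^-1.
Proof.
move=> gi gF Fi.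
have wF : in_face F (g (cube_center m)) by rewrite -gF; exists (cube_center m).
have bound x (x01 : 0 <= x <= 1) :
    exists2 y, 0 <= y <= 1 & ccoord (g (cube_center m)) i = (x + y) / 2.
  have [b _ gb] : range g (upd (g (cube_center m)) i x01).
    by rewrite gF; exact: in_face_upd.
  exists (ccoord (g (reflect_cube b)) i); first exact: ccoord_itv.
  by rewrite -{1}(mid_reflect b) isometry_mid // gb midE updE eqxx.
have [y y01 e0] := bound _ itv0; have [z z01 e1] := bound _ itv1.
by move: e0 e1; lra.
Qed.

End CubeFaces.

(** * Open cells and barycenters *)

Section Carriers.
Context {R : realType} {X : complex R}.
Local Open Scope classical_set_scope.
Local Open Scope ring_scope.
Implicit Types c d e : cell X.
Hypothesis hX : cube_complex X.

Lemma carrier_unique c d (a : cube R (cdim c)) (b : cube R (cdim d)) :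
  cube_interior a -> cube_interior b -> chart c a = chart d b ->
  existT (fun c => cube R (cdim c)) c a = existT _ d b.
Proof.
move=> ai bi ab; have [[p [_ pU]]] := (hX.1 (chart c a), tt).
by rewrite -(pU (existT _ c a)) // -(pU (existT _ d b)).
Qed.

Lemma existT_inj c (a b : cube R (cdim c)) :
  existT (fun c => cube R (cdim c)) c a = existT _ c b -> a = b.
Proof.
move=> ab; have := projT2_eq ab.
by rewrite (Prop_irrelevance (projT1_eq ab) erefl).
Qed.

Lemma chart_interior_inj c (a b : cube R (cdim c)) :
  cube_interior a -> cube_interior b -> chart c a = chart c b -> a = b.
Proof. by move=> ai bi ab; apply/existT_inj/carrier_unique. Qed.

Lemma carrier_cell d (w : cube R (cdim d)) :
  exists c (g : cube R (cdim c) -> cube R (cdim d)) (a : cube R (cdim c)),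
    [/\ cube_isometry g, range g = in_face (support_face w),
        forall b, chart d (g b) = chart c b, g a = w & cube_interior a].
Proof.
have [c [g [gi gF gc]]] := hX.2 d (support_face w).
have [a _ ga] : range g w by rewrite gF; exact: in_support_face.
by exists c, g, a; split=> //; apply: (isometry_interior gi); rewrite ga.
Qed.

Lemma carrier_at c (a : cube R (cdim c)) d (w : cube R (cdim d)) :
  cube_interior a -> chart d w = chart c a ->
  exists g : cube R (cdim c) -> cube R (cdim d),
    [/\ cube_isometry g, range g = in_face (support_face w),
        forall b, chart d (g b) = chart c b & g a = w].
Proof.
move=> ai; have [c' [g [a' [gi gF gd ga ai']]]] := carrier_cell w.
rewrite -ga gd => /(carrier_unique ai' ai) E; rewrite ga.
(* A predicate on the dependent pair lets the equality of pairs be rewritten without casts between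
   cubes. *)
pose P (p : {c : cell X & cube R (cdim c)}) :=
  exists g : cube R (cdim (projT1 p)) -> cube R (cdim d),
    [/\ cube_isometry g, range g = in_face (support_face w),
        forall b, chart d (g b) = chart (projT1 p) b & g (projT2 p) = w].
have : P (existT _ c' a') by exists g; rewrite -{1}ga; split=> //; rewrite ga.
by rewrite E.
Qed.

Definition barycenter c : pt X := chart c (cube_center (cdim c)).

Lemma barycenter_inj c d : barycenter c = barycenter d -> c = d.
Proof.
move=> /(carrier_unique (@center_interior _ _) (@center_interior _ _)).
by move=> /(congr1 (@projT1 _ _)).
Qed.

(** A barycenter met in [e] is the centre of a face of [e]. This is the origin of the constant 1/2:
    two values among 0, 1/2, 1 are equal or at least 1/2 apart. *)
Lemma barycenter_coord c e (w : cube R (cdim e)) i : chart e w = barycenter c ->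
  [\/ ccoord w i = 0, ccoord w i = 2^-1 | ccoord w i = 1].
Proof.
move/(carrier_at (@center_interior _ _)) => [g [gi gF _ gw]].
case E : (support_face w i) => [[]|].
- by constructor 3; rewrite (in_support_face E).
- by constructor 1; rewrite (in_support_face E).
- by constructor 2; rewrite -gw (isometry_center gi gF).
Qed.

(* A cell meeting another one at a point u close to a barycenter w contains
   the whole segment from u to w. *)
Lemma barycenter_transport c d e (a : cube R (cdim d)) (u w : cube R (cdim e)) :
  chart e u = chart d a -> chart e w = barycenter c -> cdist u w < 2^-1 ->
  exists2 w' : cube R (cdim d),
    chart d w' = barycenter c & cdist a w' = cdist u w.
Proof.
have [d0 [g [a0 [gi gF gd ga ai]]]] := carrier_cell a.
rewrite -ga gd => /(carrier_at ai) [h [hi hF hd hu]] ew uw.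
have [w0 _ hw] : range h w.
  (* Where the support of [u] fixes a coordinate to 0 or 1, that of [w] is less than 1/2 away and is
     0, 1/2 or 1, hence the same. So [w] lies in the face that the two cells share. *)
  rewrite hF => i b E; have ub := in_support_face E.
  have := le_lt_trans (ccoord_cdist u w i) uw; rewrite ub.
  have [->|->|->] := barycenter_coord i ew; case: (b) => //=.
  - by rewrite subr0 normr1; lra.
  - by rewrite ger0_norm; lra.
  - by rewrite sub0r normrN ger0_norm; lra.
  - by rewrite sub0r normrN normr1; lra.
by exists (g w0); [rewrite gd -hd hw | rewrite gi -hi hu hw].
Qed.

(** The barycenter is transported from cell to cell along the path; [cdist u w] plus the remaining
    length does not increase, by the triangle inequality. *)
Lemma plpath_barycenter c x y l : plpath x y l ->
  forall e (u w : cube R (cdim e)),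
    chart e u = x -> chart e w = barycenter c -> cdist u w + l < 2^-1 ->
  exists e' (u' w' : cube R (cdim e')),
    [/\ chart e' u' = y, chart e' w' = barycenter c & cdist u' w' < 2^-1].
Proof.
elim=> [z|d a b z k zk IH] e u w eu ew uwl.
  by exists e, u, w; split=> //; rewrite -[cdist _ _]addr0.
have uw : cdist u w < 2^-1.
  have := plpath_ge0 zk; have := cdist_ge0 a b; lra.
have [w' dw aw] := barycenter_transport eu ew uw.
apply: (IH d b w') => //; have := cdist_triangle b a w'.
by rewrite aw (cdistC b a); lra.
Qed.

Lemma barycenter_separated c d :
  (dist (barycenter c) (barycenter d) < 2^-1%:E)%E -> c = d.
Proof.
move=> /dballP[l cd lh].
have [|e [u [w [eu ew uw]]]] :=
  plpath_barycenter cd erefl erefl (e := c) (u := cube_center _) (w := cube_center _).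
  by rewrite cdistxx add0r.
apply: barycenter_inj; rewrite -ew -eu; congr chart; apply: cube_eq => i.
have := le_lt_trans (ccoord_cdist u w i) uw.
have [->|->|->] := barycenter_coord i ew;
  have [->|->|->] := barycenter_coord i eu; rewrite ?ltr_norml; lra.
Qed.

(** Near-covering compactness is applied to the cofinite filter on cells: if, near each point, all
    but finitely many barycenters are 1/8 away, then all but finitely many cells have a barycenter
    1/8 away from every point, itself included, which is absurd. *)
Lemma finite_cells : compact [set: pt X] -> finite_set [set: cell X].
Proof.
move=> /compact_near_coveringP cX.
pose F : set_system (cell X) := [set A | finite_set (~` A)].
have FF : Filter F.
  split; first by rewrite /F /= setCT.
  - by move=> A B; rewrite /F /= setCI finite_setU.
  - by move=> A B AB; apply: sub_finite_set; exact: subsetC.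
have := cX _ F (fun c x => ~ dball (barycenter c) 8^-1 x) FF.
suff /[swap] /[apply] : forall x, [set: pt X] x ->
    \forall x' \near x & i \near F, ~ dball (barycenter i) 8^-1 x'.
  rewrite /prop_near1 /nbhs /= /F /=; apply: sub_finite_set => c _ /= /(_ _ I).
  by apply; apply: dball_center; rewrite invr_gt0.
(* At most one barycenter is within 1/4 of [x], since 1/4 + 1/4 = 1/2; the others are at least 1/8
   away from the whole ball of radius 1/8. *)
move=> x _; exists (ball x 8^-1, [set c | ~ dball (barycenter c) 4^-1 x]) => /=.
  split; first by apply: nbhsx_ballx; rewrite invr_gt0.
  rewrite /F /=.
  have [[c cx]|none] := pselect (exists c, dball (barycenter c) 4^-1 x).
    apply: (@sub_finite_set _ _ [set c]); last exact: finite_set1.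
    move=> d /= /contrapT dx; apply: barycenter_separated.
    have := dball_triangle dx (dball_sym cx); rewrite /dball.
    by rewrite (_ : 4^-1 + 4^-1 = 2^-1 :> R) //; field.
  apply: (@sub_finite_set _ _ set0); last exact: finite_set0.
  by move=> c /= /contrapT cx; apply: none; exists c.
move=> [y c] /= [xy cN] cy; apply: cN.
have := dball_triangle cy (dball_sym xy).
by rewrite (_ : 8^-1 + 8^-1 = 4^-1 :> R) //; field.
Qed.

Lemma compact_finite_dimensional : compact [set: pt X] -> finite_dimensional X.
Proof.
move=> /finite_cells /(finite_image (@cdim R X)) /finite_seqP[s sE].
exists (\max_(n <- s) n) => c; apply: leq_bigmax_seq => //.
by have : [set` s] (cdim c) by rewrite -sE; exists c.
Qed.

End Carriers.

(** * Isometries of cubes are determined on vertices *)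

Section CubeVertices.
Context {R : realType}.
Local Open Scope classical_set_scope.
Local Open Scope ring_scope.

Definition cube_vertex n (w : cube R n) :=
  forall i, ccoord w i = 0 \/ ccoord w i = 1.

(** Vertices are the extreme points. Stated with midpoints, this is a metric property, which
    isometries onto the cube preserve. *)
Lemma cube_vertexP n (w : cube R n) :
  cube_vertex w <-> forall a b, mid a b = w -> a = b.
Proof.
split=> [wv a b ab|ext i].
  apply: cube_eq => i; have := wv i; rewrite -ab midE.
  by have := ccoord_itv a i; have := ccoord_itv b i => ? ? []; lra.
have mid_upd x y (x01 : 0 <= x <= 1) (y01 : 0 <= y <= 1) :
    x + y = ccoord w i * 2 -> x = y.
  move=> xy; have /(congr1 (fun a => ccoord a i)) : upd w i x01 = upd w i y01.
    apply: ext; apply: cube_eq => j; rewrite midE !updE.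
    by case: eqP => [->|_]; [rewrite xy mulfK | field].
  by rewrite !updE eqxx.
have := ccoord_itv w i; have [lo|hi] := leP (ccoord w i) 2^-1 => wi.
  have x01 : 0 <= ccoord w i * 2 <= 1 by lra.
  by have := mid_upd _ _ x01 itv0; rewrite addr0 => /(_ erefl); left; lra.
have x01 : 0 <= ccoord w i * 2 - 1 <= 1 by lra.
by have := mid_upd _ _ x01 itv1; rewrite subrK => /(_ erefl); right; lra.
Qed.

Lemma isometry_vertex m n (g : cube R m -> cube R n) (w : cube R m) :
  cube_isometry g -> range g = setT -> cube_vertex (g w) <-> cube_vertex w.
Proof.
move=> gi gT; rewrite !cube_vertexP; split=> ext a b.
  move=> ab; apply/(cube_isometry_inj gi)/ext.
  by rewrite -isometry_mid // ab.
have [a' _ <-] : range g a by rewrite gT.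
have [b' _ <-] : range g b by rewrite gT.
by rewrite -isometry_mid // => /(cube_isometry_inj gi)/ext ->.
Qed.

Lemma origin_vertex n : cube_vertex (@origin R n).
Proof. by move=> i; left; rewrite ccoordE. Qed.

Lemma unit_vertex n (i : 'I_n) : cube_vertex (upd (origin n) i (@itv1 R)).
Proof. by move=> j; rewrite updE; case: eqP => _; [right|left; rewrite ccoordE]. Qed.

(** Polarisation: a coordinate is recovered from the distances to two vertices, so the distances to
    the vertices determine a point. *)
Lemma cdist_sq_unit n (a : cube R n) i :
  cdist a (origin n) ^+ 2 - cdist a (upd (origin n) i (@itv1 R)) ^+ 2 =
  ccoord a i *+ 2 - 1.
Proof.
rewrite !cdist_sq (bigD1 i) //= [X in _ - X](bigD1 i) //=.
rewrite updE eqxx ccoordE subr0.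
rewrite [X in _ - (_ + X)](eq_bigr
  (fun j => (ccoord a j - ccoord (@origin R n) j) ^+ 2)).
  by ring.
by move=> j /negPf ji; rewrite updE ji.
Qed.

Lemma cube_eq_vertices n (a b : cube R n) :
  (forall w, cube_vertex w -> cdist a w = cdist b w) -> a = b.
Proof.
move=> ab; apply: cube_eq => i; have := cdist_sq_unit a i.
rewrite !ab; [|exact: unit_vertex|exact: origin_vertex].
by rewrite cdist_sq_unit; lra.
Qed.

Lemma isometry_eq_vertices m n (g h : cube R m -> cube R n) :
  cube_isometry g -> range g = setT -> cube_isometry h ->
  (forall w, cube_vertex w -> g w = h w) -> g =1 h.
Proof.
move=> gi gT hi gh a; apply: cube_eq_vertices => w.
have [u _ <-] : range g w by rewrite gT.
by move=> /(isometry_vertex u gi gT) uv; rewrite gi gh // hi.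
Qed.

End CubeVertices.

(** * Finiteness of the automorphism group *)

Section FiniteAutomorphisms.
Context {R : realType} {X : complex R}.
Local Open Scope classical_set_scope.
Local Open Scope ring_scope.
Variables v vs : cell X.
Variables (N : nat) (dimX : forall c : cell X, (cdim c <= N)%N).
Variables (s : seq {classic (cell X)}).
Hypothesis sX : forall c : {classic (cell X)}, c \in s.
Hypothesis chart_onto : forall x : pt X, exists c a, x = chart c a.

(** One finite type codes the vertices of the cubes of all dimensions up to N, the bits beyond the
    dimension being false; N + 1 bits rather than N make [inord] available. *)
Let bits := {ffun 'I_N.+1 -> bool}.

Let encode n (w : cube R n) : bits :=
  [ffun k : 'I_N.+1 => [exists i : 'I_n, (i == k :> nat) && (ccoord w i == 1)]].

Let encode_inj n (a b : cube R n) : (n <= N)%N ->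
  cube_vertex a -> cube_vertex b -> encode a = encode b -> a = b.
Proof.
move=> nN av bv ab; apply: cube_eq => i.
have iN : (i < N.+1)%N by rewrite ltnS (leq_trans (ltnW (ltn_ord i))).
have enc (w : cube R n) : encode w (Ordinal iN) = (ccoord w i == 1).
  rewrite ffunE; apply/existsP/idP => [[j /andP[/eqP/= ji wj]]|wi].
    by rewrite -(_ : j = i) //; exact: val_inj.
  by exists i; rewrite eqxx.
have := enc b; rewrite -ab enc.
by case: (av i) (bv i) => -> [] ->; rewrite ?eqxx // ?(eq_sym 0) oner_eq0.
Qed.

Let decode n (b : bits) : cube R n.
Proof.
apply: (@mkcube R n (fun i => (b (inord i))%:R)) => i.
by case: (b _); rewrite ?itv0 ?itv1.
Defined.

Let decode_vertex n (b : bits) : cube_vertex (decode n b).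
Proof. by move=> i; rewrite ccoordE; case: (b _); [right|left]. Qed.

Let encodeK n (w : cube R n) : (n <= N)%N -> cube_vertex w ->
  decode n (encode w) = w.
Proof.
move=> nN wv; apply: (encode_inj nN) => //.
apply/ffunP => k; rewrite [LHS]ffunE.
have [kn|nk] := ltnP k n; last first.
  rewrite ffunE; apply: eq_existsb => i.
  by rewrite (_ : (i == k :> nat) = false) // ltn_eqF // (leq_trans (ltn_ord i)).
transitivity (ccoord (decode n (encode w)) (Ordinal kn) == 1).
  apply/existsP/idP => [[i /andP[/eqP ik]]|]; last first.
    by exists (Ordinal kn); rewrite eqxx.
  by rewrite (_ : i = Ordinal kn) //; exact: val_inj.
rewrite ccoordE /= (_ : inord k = k); last by apply: val_inj; rewrite /= inordK.
by case: (encode w k); rewrite ?eqxx // eq_sym oner_eq0.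
Qed.

(** The image cell and the table of the isometry on vertices are finite data that determine [f] on
    the cell [c]. *)
Let describes (f : pt X -> pt X) (c c' : cell X) (h : {ffun bits -> bits}) :=
  exists g : cube R (cdim c) -> cube R (cdim c'),
    [/\ cube_isometry g, range g = setT, forall a, f (chart c a) = chart c' (g a)
      & forall b, h b = encode (g (decode _ b))].

Let describes_eq f f' c c' h : describes f c c' h -> describes f' c c' h ->
  forall a, f (chart c a) = f' (chart c a).
Proof.
move=> [g [gi gT gf gh]] [g' [gi' gT' gf' gh']] a; rewrite gf gf'; congr chart.
apply: isometry_eq_vertices => // w wv; apply: (encode_inj (dimX c')).
- exact/isometry_vertex.
- exact/isometry_vertex.
by rewrite -(encodeK (dimX c) wv) -gh gh'.
Qed.

Lemma FixAut_finite : exists (T : finType) (h : FixAut v vs -> T), injective h.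
Proof.
have ex (f : FixAut v vs) c : exists p : cell X * {ffun bits -> bits},
    describes (sval f) c p.1 p.2.
  have [[f' [_ _ fC _]] _ _] := svalP f.
  have [c' [g [gi gT gf]]] := fC c.
  exists (c', [ffun b => encode (g (decode _ b))]); exists g; split=> // b.
  by rewrite ffunE.
pose code f c := sval (cid (ex f c)).
pose T := {ffun 'I_(size s) -> 'I_(size s).+1 * {ffun bits -> bits}}.
pose idx (c : {classic (cell X)}) := index c s.
have idxP c : (idx c < size s)%N by rewrite index_mem.
have idxK c d : nth d s (idx c) = c by exact: nth_index.
exists T, (fun f => [ffun k => (inord (idx (code f (tnth (in_tuple s) k)).1),
                                (code f (tnth (in_tuple s) k)).2)]).
move=> f f' /ffunP ff'; apply: Aut_eq => x; have [c [a ->]] := chart_onto x.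
have := ff' (Ordinal (idxP c)); rewrite !ffunE !(tnth_nth c) /= idxK.
case=> /(congr1 val); rewrite /= !inordK ?ltnS ?(ltnW (idxP _)) // => e1 e2.
have {}e1 : (code f c).1 = (code f' c).1.
  by rewrite -(idxK (code f c).1 c) e1 idxK.
have := svalP (cid (ex f c)); have := svalP (cid (ex f' c)).
rewrite -/(code f c) -/(code f' c) -e1 -e2 => d' d.
exact: (describes_eq d d').
Qed.

End FiniteAutomorphisms.

Section CompactComplexes.
Context {R : realType} {X : complex R}.
Local Open Scope classical_set_scope.
Hypotheses (hX : cube_complex X) (cX : compact [set: pt X]).

Lemma chart_onto (x : pt X) : exists c a, x = chart c a.
Proof. by have [[c a] [[_ <-] _]] := hX.1 x; exists c, a. Qed.

Lemma compact_FixAut_finite (v vs : cell X) :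
  exists (T : finType) (h : FixAut v vs -> T), injective h.
Proof.
have [N dimX] := compact_finite_dimensional hX cX.
have /(@finite_seqP {classic (cell X)})[s sE] := finite_cells hX cX.
apply: (FixAut_finite v vs dimX (s := s)) chart_onto => c.
by have : [set` s] c by rewrite -sE.
Qed.

End CompactComplexes.

(** * Groups, words and laws *)

Section AbstractGroups.
Local Open Scope classical_set_scope.
Local Open Scope group_scope.
Implicit Types G H : groupType.

Lemma subgroupM G (K : set G) x y : subgroup K -> K x -> K y -> K (x * y).
Proof.
move=> [K1 KV] Kx Ky; have := KV _ _ Kx (KV _ _ K1 Ky).
by rewrite mul1g invgK.
Qed.

Lemma subgroupV G (K : set G) x : subgroup K -> K x -> K x^-1.
Proof. by move=> [K1 KV] Kx; have := KV _ _ K1 Kx; rewrite mul1g. Qed.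

Lemma subgroupR G (K : set G) x y : subgroup K -> K x -> K y -> K [~ x, y].
Proof.
move=> sK Kx Ky; rewrite /commg /conjg.
by do ! [apply: subgroupM | apply: subgroupV].
Qed.

Lemma gen_subgroupP G (S : set G) : subgroup (gen_subgroup S).
Proof.
split=> [K [sK _]|x y Sx Sy K KS]; first by case: sK.
by case: (KS) => -[_ KV] _; apply: KV; [exact: Sx | exact: Sy].
Qed.

Lemma sub_gen_subgroup G (S : set G) : S `<=` gen_subgroup S.
Proof. by move=> x Sx K [_]; apply. Qed.

Lemma gen_subgroup_min G (S K : set G) :
  subgroup K -> S `<=` K -> gen_subgroup S `<=` K.
Proof. by move=> sK SK x; apply. Qed.

Lemma derived_subgroup G (K : set G) n :
  subgroup K -> subgroup (derived_series K n).
Proof. by case: n => // n _; exact: gen_subgroupP. Qed.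

Lemma derived_mono G (K L : set G) n :
  K `<=` L -> derived_series K n `<=` derived_series L n.
Proof.
move=> KL; elim: n => //= n IH; apply: gen_subgroup_min; first exact: gen_subgroupP.
move=> _ [x Kx [y Ky <-]]; apply: sub_gen_subgroup.
by exists x; [exact: IH | exists y => //; exact: IH].
Qed.

(** Multiplicativity is asked on [K] only: the coordinate projections of the wreath product, to
    which this is applied, are morphisms on the base group and not on the whole group. *)
Lemma derived_image G H (K : set G) (f : G -> H) n : subgroup K ->
  (forall x y, K x -> K y -> f (x * y) = f x * f y) ->
  f @` K = setT ->
  derived_series [set: H] n `<=` f @` derived_series K n.
Proof.
move=> sK fM fK.
have f1 : f 1 = 1.
  by apply: (mulgI (f 1)); rewrite -fM ?mulg1 //; case: sK.
have fV x : K x -> f x^-1 = (f x)^-1.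
  by move=> Kx; apply: (mulgI (f x)); rewrite -fM ?mulgV ?f1 //; exact: subgroupV.
have sub k : derived_series K k `<=` K.
  elim: k => //= k IH; apply: gen_subgroup_min => // _ [x Kx [y Ky <-]].
  by apply: subgroupR => //; exact: IH.
elim: n => [|n IH] /=; first by rewrite fK.
set D := derived_series K n.
have sD : subgroup D by exact: derived_subgroup.
set S := [set [~ x, y] | x in D & y in D].
have SK : gen_subgroup S `<=` K by exact: (sub n.+1).
have sS := gen_subgroupP S.
apply: gen_subgroup_min.
  split; first by exists 1; [case: sS | ].
  move=> _ _ [x Sx <-] [y Sy <-]; exists (x * y^-1); first by case: sS => _; apply.
  by rewrite fM ?fV //; [exact: SK | exact: SK | apply: subgroupV => //; exact: SK].
move=> _ [a /IH[x Dx <-] [b /IH[y Dy <-] <-]]; exists [~ x, y].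
  by apply: sub_gen_subgroup; exists x => //; exists y.
have [Kx Ky] := (sub _ _ Dx, sub _ _ Dy).
rewrite /commg /conjg !fM ?fV //;
  by do ! [apply: subgroupM | apply: subgroupV].
Qed.

Lemma solvable_image G H (K : set G) (f : G -> H) : subgroup K ->
  (forall x y, K x -> K y -> f (x * y) = f x * f y) ->
  f @` K = setT -> solvable_subgroup K -> solvable_group H.
Proof.
move=> sK fM fK [n nK]; exists n => h /(derived_image sK fM fK)[x /nK -> <-].
by apply: (mulgI (f 1)); rewrite -fM ?mulg1 //; case: sK.
Qed.

Lemma isomorphic_sym G H : isomorphic G H -> isomorphic H G.
Proof.
move=> [f [[g fK gK] fM]]; exists g; split; first by exists f.
by move=> x y; apply: (can_inj fK); rewrite fM !gK.
Qed.

Lemma isomorphic_refl G : isomorphic G G.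
Proof. by exists id; split=> //; exists id. Qed.

Lemma isomorphic_solvable G H :
  isomorphic G H -> solvable_group G -> solvable_group H.
Proof.
move=> [f [[g fK gK] fM]]; apply: (@solvable_image _ _ _ f) => //.
by apply/seteqP; split=> // y _; exists (g y).
Qed.

Lemma abelian_virtually_solvable G :
  (forall x y : G, x * y = y * x) -> virtually_solvable G.
Proof.
move=> GC; exists setT; split=> //; first by exists [:: 1] => g; exists 1;
  rewrite ?mem_head.
exists 1%N; apply: gen_subgroup_min.
  by split=> // x y -> ->; rewrite mulgV.
by move=> _ [x _ [y _ <-]] /=; rewrite /commg /conjg (GC x) mulKg mulVg.
Qed.

(** Among the first |T| + 1 powers of [g] two coincide, so [g] has an order at most |T|, which
    divides |T| factorial. *)
Lemma finite_exponent G (T : finType) (h : G -> T) : injective h ->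
  exists2 N, (0 < N)%N & forall g : G, g ^+ N = 1.
Proof.
move=> hI; exists (factorial #|T|); first exact: fact_gt0.
move=> g; pose f (i : 'I_#|T|.+1) := h (g ^+ i).
have /injectivePn[i [j ij fij]] : ~~ injectiveb f.
  by apply/negP => /injectiveP/leq_card; rewrite card_ord ltnn.
wlog ltij : i j ij fij / (i < j)%N.
  have := ij; rewrite -val_eqE neq_ltn => /orP[] lt wl; first exact: (wl i j).
  by apply: (wl j i) => //; rewrite eq_sym.
have gij : g ^+ (j - i) = 1.
  apply: (mulgI (g ^+ i)); rewrite -expgnDr subnKC ?(ltnW ltij) // mulg1.
  by symmetry; exact: hI.
have /dvdnP[k ->] : (j - i %| factorial #|T|)%N.
  by apply: dvdn_fact; rewrite subn_gt0 ltij (leq_trans (leq_subr _ _)) // -ltnS.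
by rewrite mulnC expgnA gij expg1n.
Qed.

Lemma finite_listing (A : choiceType) (T : finType) (h : A -> T) : injective h ->
  exists s : seq A, forall a, a \in s.
Proof.
move=> hI; have : finite_set [set: A].
  rewrite -(preimage_setT h); apply: finite_preimage.
    by move=> ? ? _ _; exact: hI.
  exact: finite_finset.
by move/finite_seqP=> [s sE]; exists s => a; have : [set` s] a by rewrite -sE.
Qed.

End AbstractGroups.

(** * Words, the commutator law and generation *)

Section Words.
Local Open Scope classical_set_scope.
Local Open Scope group_scope.
Variable G : groupType.

Lemma eval_word_cat T (f : T -> G) (w w' : seq (T * bool)) :
  eval_word f (w ++ w') = eval_word f w * eval_word f w'.
Proof. by elim: w => [|p w IH] /=; rewrite ?mul1g // IH mulgA. Qed.

Definition comm_word (T : Type) (a b : T) : seq (T * bool) :=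
  [:: (a, true); (b, true); (a, false); (b, false)].

(** The letters alternate between [a] and [b], also where two copies meet, so no cancellation occurs
    in any power once [a != b]. *)
Definition comm_power (T : Type) (a b : T) N : seq (T * bool) :=
  flatten (nseq N (comm_word a b)).

Lemma eval_comm_power T (f : T -> G) a b N :
  eval_word f (comm_power a b N) = [~ f a, f b] ^+ N.
Proof.
elim: N => [|N IH]; first by rewrite expg0.
by rewrite expgS -IH /= /commg /conjg !mulgA.
Qed.

Lemma size_comm_power (T : Type) (a b : T) N : size (comm_power a b N) = (4 * N)%N.
Proof. by rewrite /comm_power size_flatten /shape map_nseq sumn_nseq. Qed.

Lemma reduced_comm_power (T : eqType) (a b : T) N :
  a != b -> reduced (comm_power a b N).
Proof.
move=> ab; case: N => //= N; rewrite /reduced /=.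
have ba : b != a by rewrite eq_sym.
rewrite (negPf ab) (negPf ba) /=; elim: N => //= N IH.
by rewrite (negPf ab) (negPf ba) /= IH.
Qed.

Lemma comm_power_law N : (0 < N)%N ->
  (forall x y : G, [~ x, y] ^+ N = 1) -> satisfies_law G.
Proof.
move=> N0 GN; exists 2, (comm_power ord0 ord_max N); split.
- by rewrite -size_eq0 size_comm_power muln_eq0 -lt0n N0.
- exact: reduced_comm_power.
- by move=> f; rewrite eval_comm_power.
Qed.

Variable S : seq G.

Definition word_values : set G :=
  [set g | exists2 w, word_in S w & eval_word id w = g].

Lemma word_values1 : word_values 1. Proof. by exists [::]. Qed.

Lemma word_valuesM x y : word_values x -> word_values y -> word_values (x * y).
Proof.
move=> [w wS <-] [w' wS' <-]; exists (w ++ w'); last exact: eval_word_cat.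
by rewrite /word_in all_cat; apply/andP.
Qed.

Lemma word_values_gen x : x \in S -> word_values x.
Proof. by move=> xS; exists [:: (x, false)]; rewrite /word_in /= ?mulg1 ?xS. Qed.

Lemma word_valuesV x : word_values x -> word_values x^-1.
Proof.
move=> [w + <-]; elim: w => [|[a b] w IH] /=; first by rewrite invg1; exists [::].
move=> /andP[aS /IH wS]; rewrite invgM; apply: word_valuesM => //.
exists [:: (a, ~~ b)]; rewrite /word_in /= ?aS // mulg1.
by case: b; rewrite /= ?invgK.
Qed.

Lemma word_values_centralise z x :
  (forall a, a \in S -> a * z = z * a) -> word_values x -> x * z = z * x.
Proof.
move=> Sz [w + <-]; elim: w => [|[a b] w IH] /=; first by rewrite mulg1 mul1g.
move=> /andP[/Sz az /IH wz]; rewrite -mulgA wz !mulgA; congr (_ * _).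
case: b => //; apply: (mulgI a); rewrite !mulgA mulgV mul1g az.
by rewrite -mulgA mulgV mulg1.
Qed.

End Words.

Lemma comm_power_girth (R : realType) (G : groupType) N : (0 < N)%N ->
  (forall x y : G, [~ x, y] ^+ N = 1)%g -> ~ virtually_solvable G ->
  (girth R G < +oo)%E.
Proof.
move=> N0 GN nvs; apply: (@le_lt_trans _ _ (4 * N)%:R%:E); last exact: ltry.
apply: ge_ereal_sup => _ [S Sgen <-].
have [a [b [aS bS ab]]] : exists a b, [/\ a \in S, b \in S & a != b].
  (* Without two distinct generators all generators commute, and the group is abelian. *)
  apply: contrapT => none; apply: nvs; apply: abelian_virtually_solvable => x y.
  apply: word_values_centralise (Sgen x) => a aS; symmetry.
  apply: word_values_centralise (Sgen y) => b bS.
  have [->//|ab] := eqVneq a b; exfalso; apply: none.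
  by exists a, b.
apply: ereal_inf_lbound; exists (comm_power a b N); last by rewrite size_comm_power.
split.
- by rewrite -size_eq0 size_comm_power muln_eq0 -lt0n N0.
- exact: reduced_comm_power.
- by rewrite /word_in /comm_power; elim: (N) => //= k ->; rewrite aS bS.
- by rewrite eval_comm_power.
Qed.

(** * The wreath product *)

Section Lamplighter.
Local Open Scope classical_set_scope.
Local Open Scope group_scope.
Variable A : groupType.
Local Notation G := (Defs.sdprod (shift_action A)).
Local Notation lamp := (dsum int A).
Local Notation pair n k := (SDPair (shift_action A) n k).

Lemma lampE (n m : lamp) : pair n 1 * pair m 1 = pair (n * m) 1.
Proof. by congr SDPair; rewrite /= shift1. Qed.

Lemma lamp_expE (n : lamp) k : (pair n 1) ^+ k = pair (n ^+ k) 1.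
Proof. by elim: k => // k IH; rewrite !expgS IH lampE. Qed.

Lemma dsum_expE (n : lamp) k i : sval (n ^+ k) i = (sval n i) ^+ k.
Proof. by elim: k => // k IH; rewrite !expgS -IH. Qed.

Lemma sdH_comm (x y : G) : sdH [~ x, y] = 1.
Proof.
rewrite /commg /conjg /=; change (- sdH x + (- sdH y + (sdH x + sdH y)) = 0)%R.
by ring.
Qed.

Lemma lamplighter_exponent N : (forall a : A, a ^+ N = 1) ->
  forall x y : G, [~ x, y] ^+ N = 1.
Proof.
move=> AN x y; have := sdH_comm x y; case: [~ x, y] => n k /= ->.
rewrite lamp_expE; congr SDPair; apply: dsum_eq => i.
by rewrite dsum_expE AN.
Qed.

Lemma single_subproof (i : int) (a : A) :
  fin_support (fun j => if j == i then a else 1).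
Proof.
apply: (@sub_finite_set _ _ [set i]); last exact: finite_set1.
by move=> j /=; case: eqP.
Qed.

Definition single i a : lamp := exist _ _ (single_subproof i a).

Lemma lamplighter_not_virtually_solvable :
  ~ solvable_group A -> ~ virtually_solvable G.
Proof.
move=> nsol [H [sH [s sfin] [n Hn]]].
have [[i Hi]|none] := pselect (exists i, forall a,
    exists2 m : lamp, H (pair m 1) & sval m i = a).
  apply: nsol; apply: (@solvable_image _ _ [set g | H g /\ sdH g = 1]
    (fun g => sval (sdN g) i)).
  - split; first by case: sH.
    move=> x y [Hx x1] [Hy y1]; split; first by case: sH => _; apply.
    by rewrite /= x1 y1 mulgV.
  - move=> x y [_ x1] _; change (sval (sdN x * dshift (sdH x) (sdN y)) i =
      sval (sdN x) i * sval (sdN y) i).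
    by rewrite x1 shift1.
  - apply/seteqP; split=> // a _; have [m Hm <-] := Hi a.
    by exists (pair m 1).
  - exists n => x /(derived_mono (L := H)) Hx; apply: Hn; apply: Hx.
    by move=> ? [].
(* Each coordinate i omits a value a i on H; the elements with the single
   coordinate a i at i then lie in distinct cosets. *)
have /choice[a aP] i : exists a, forall m : lamp, H (pair m 1) -> sval m i <> a.
  apply: contrapT => all_hit; apply: none; exists i => a.
  apply: contrapT => not_hit; apply: all_hit; exists a => m Hm mi.
  by apply: not_hit; exists m.
pose x (i : nat) := pair (single (Posz i) (a (Posz i))) 1.
have /choice[t tP] i : exists t, t \in s /\ H (t^-1 * x i).
  by have [t] := sfin (x i); exists t.
have idx i : (index (t i) s < size s)%N by rewrite index_mem (tP i).1.
(* Pigeonhole: [size s] cosets for one more element [x i]. *)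
have /injectivePn[i [j ij [/(congr1 (nth 1 s))]]] :
    ~~ injectiveb (fun i : 'I_(size s).+1 => Ordinal (idx i)).
  by apply/negP => /injectiveP/leq_card; rewrite !card_ord ltnn.
rewrite !nth_index ?(tP _).1 // => tij.
have : H ((x i)^-1 * x j).
  have -> : (x i)^-1 * x j = ((t i)^-1 * x i)^-1 * ((t j)^-1 * x j).
    by rewrite -tij invgM invgK -mulgA mulKVg.
  apply: subgroupM => //; last exact: (tP j).2.
  by apply: subgroupV => //; exact: (tP i).2.
have -> : (x i)^-1 * x j =
    pair ((single (Posz i) (a (Posz i)))^-1 * single (Posz j) (a (Posz j))) 1.
  by congr SDPair; apply: dsum_eq => k /=; rewrite /= ?subr0.
(* At coordinate j the factor of index i is trivial, so this element of H takes there the omitted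
   value. *)
move=> Hx; apply: (aP (Posz j) _ Hx) => /=; rewrite eqxx.
rewrite (_ : (Posz j == Posz i) = false) ?invg1 ?mul1g //.
by rewrite eqz_nat eq_sym val_eqE (negPf ij).
Qed.

(** The shift and the copy of A at coordinate 0 generate: conjugation by powers of the shift carries
    that copy to every coordinate, and finite support makes a lamp a finite product. *)
Lemma lamplighter_finitely_generated (s : seq A) : (forall a, a \in s) ->
  finitely_generated G.
Proof.
move=> sA; pose t : G := pair 1 (1%R : int).
pose S : seq G := t :: [seq pair (single 0%R a) 1 | a <- s].
exists S; pose W := word_values S.
have WM := @word_valuesM G S; have WV := @word_valuesV G S.
have Wt (k : int) : W (pair 1 k).
  have Wn n : W (pair 1 (Posz n)).
    elim: n => [|n IH]; first exact: word_values1.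
    have -> : pair 1 (Posz n.+1) = t * pair 1 (Posz n).
      congr SDPair; first by apply: dsum_eq => i /=; rewrite mulg1.
    by apply: WM IH; apply: word_values_gen; rewrite inE eqxx.
  case: k => n; first exact: Wn.
  have -> : pair 1 (Negz n) = (pair 1 (Posz n.+1))^-1.
    by congr SDPair; apply: dsum_eq => i /=; rewrite invg1.
  exact/WV/Wn.
have Wsingle i a : W (pair (single i a) 1).
  have -> : pair (single i a) 1 = pair 1 i * pair (single 0%R a) 1 * pair 1 (- i)%R.
    congr SDPair; last first.
      by change (0 = i + 0 + (- i))%R; rewrite addr0 subrr.
    by apply: dsum_eq => j /=; rewrite mul1g mulg1 subr_eq0.
  apply: (WM _ _ (WM _ _ (Wt _) _) (Wt _)); apply: word_values_gen.
  by rewrite inE map_f ?orbT.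
have Wlamp (n : lamp) : W (pair n 1).
  have /finite_seqP[l lE] := svalP n.
  (* Only the inclusion of the support in [l] is kept, so that the induction can clear one
     coordinate at a time. *)
  have {lE} : forall i, i \notin l -> sval n i = 1.
    move=> i il; apply: contrapT => ni; have : [set` l] i by rewrite -lE.
    by rewrite /= (negPf il).
  elim: l n => [|i l IH] n nl.
    rewrite (_ : n = 1); first exact: word_values1.
    by apply: dsum_eq => i; rewrite nl.
  have -> : n = single i (sval n i) * ((single i (sval n i))^-1 * n).
    by rewrite mulKVg.
  rewrite -lampE; apply: WM; first exact: Wsingle.
  apply: IH => j jl /=; case: eqP => [->|/eqP ji]; first by rewrite mulVg.
  by rewrite invg1 mul1g nl // inE negb_or ji.
move=> [n k]; have -> : pair n k = pair n 1 * pair 1 k.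
  congr SDPair; last by change (k = 0 + k)%R; rewrite add0r.
  by apply: dsum_eq => i /=; rewrite mulg1.
exact: (WM _ _ (Wlamp n) (Wt k)).
Qed.

End Lamplighter.

Section LamplighterWreath.
Local Open Scope classical_set_scope.
Local Open Scope group_scope.

Lemma lamp_map_subproof (I : Type) (A B : groupType) (f : A -> B) (n : dsum I A) :
  f 1 = 1 -> fin_support (fun i => f (sval n i)).
Proof.
move=> f1; apply: (@sub_finite_set _ _ [set i | sval n i <> 1]); last exact: svalP n.
by move=> i /= fn n1; apply: fn; rewrite n1.
Qed.

(** The isomorphism is taken coordinatewise; the two actions reindex by i - k and by - k + i, which
    agree because the integers commute. *)
Lemma lamplighter_wreath (A B : groupType) : isomorphic A B ->
  isomorphic (Defs.sdprod (shift_action A)) (wreath B Zgrp).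
Proof.
move=> [f [[g fK gK] fM]].
have f1 : f 1 = 1 by apply: (mulgI (f 1)); rewrite -fM !mulg1.
have g1 : g 1 = 1 by rewrite -{1}f1 fK.
pose F (x : Defs.sdprod (shift_action A)) : wreath B Zgrp :=
  @SDPair Zgrp (dsum Zgrp B) _ (exist _ _ (lamp_map_subproof (sdN x) f1)) (sdH x).
pose F' (x : wreath B Zgrp) : Defs.sdprod (shift_action A) :=
  @SDPair Zgrp (dsum int A) _ (exist _ _ (lamp_map_subproof (sdN x) g1)) (sdH x).
exists F; split.
  exists F'; move=> [n k]; congr SDPair; apply: dsum_eq => i /=; first exact: fK.
  exact: gK.
move=> [n k] [m l]; congr SDPair; apply: dsum_eq => i /=; rewrite fM.
by congr (_ * f (sval m _)); change (i - k = - k + i)%R; rewrite addrC.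
Qed.

End LamplighterWreath.

(** * Non-solvability of the symmetric groups *)

Section SymmetricGroup.
Import nilpotent alt.
Local Open Scope classical_set_scope.
Local Open Scope group_scope.

Lemma gen_sub_gen_subgroup (gT : finGroupType) (A : {set gT}) (K : set gT) :
  subgroup K -> (forall x, x \in A -> K x) -> forall x, x \in <<A>> -> K x.
Proof.
move=> sK AK x /gen_prodgP[n [c cA ->]].
elim: n c cA => [|n IH] c cA; first by rewrite big_ord0; case: sK.
rewrite big_ord_recl; apply: subgroupM => //; first exact: AK.
by apply: IH => i.
Qed.

(** In MathComp, solvability says that a subgroup contained in its own commutator subgroup is
    trivial; such a subgroup lies in every term of the derived series. *)
Lemma solvable_group_solvable (gT : finGroupType) (G : {group gT}) :
  solvable_group gT -> solvable G.
Proof.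
move=> [n nT]; apply/forallP => H; apply/implyP.
rewrite finset.subsetI => /andP[_ HH]; rewrite -subG1.
apply/fintype.subsetP => x Hx; rewrite inE; apply/eqP/nT => {nT}.
elim: n x Hx => //= n IH x /(fintype.subsetP HH).
apply: gen_sub_gen_subgroup; first exact: gen_subgroupP.
move=> _ /imset2P[a b aH bH ->]; apply: sub_gen_subgroup.
by exists a; [exact: IH | exists b => //; exact: IH].
Qed.

Lemma Sym_not_solvable m : (5 <= m)%N -> ~ solvable_group 'S_m.
Proof.
move=> m5 /(solvable_group_solvable 'Alt_('I_m)).
by rewrite solvable_AltF // card_ord.
Qed.

End SymmetricGroup.

(** * The metric of the line *)

Section Quotients.
Local Open Scope classical_set_scope.
Variables (T : Type) (r : T -> T -> Prop).

Lemma clsP (x y : T) : cls r x = cls r y <-> clos_refl_sym_trans _ r x y.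
Proof.
split=> [/(congr1 sval)/= /seteqP[_ /(_ y)]|]; first by apply; exact: rst_refl.
move=> xy; rewrite /cls; apply: eq_exist; apply/seteqP.
by split=> z /=; apply: rst_trans => //; exact: rst_sym.
Qed.

Lemma repK (q : quot r) : cls r (rep q) = q.
Proof.
case: q => S hS; rewrite /cls; apply: eq_exist.
by rewrite /rep; case: cid => x /= ->.
Qed.

End Quotients.

Section GlueRelation.
Local Open Scope ring_scope.
Variables (T : Type) (a b : T).
Local Notation glue := (glue_rel a b).

(** Two gluings never chain: the end of one would have to be both [a] and [b], unless the second
    undoes the first or repeats it. *)
Lemma clos_glue (p q : int * T) : a <> b -> clos_refl_sym_trans _ glue p q ->
  [\/ p = q, glue p q | glue q p].
Proof.
move=> ab; elim=> {p q} [p q|p|p q _|p q s _ IH _ IH'].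
- by constructor 2.
- by constructor 1.
- by case; [constructor 1 | constructor 3 | constructor 2].
case: IH IH' => [->//|pq|qp] [<-|qs|sq]; try by [constructor 2 | constructor 3].
- by case: pq qs => _ qa _ [qb _ _]; case: ab; rewrite -qa.
- constructor 1; case: pq sq => pb _ q1 [sb _ q1'].
  by case: p s pb sb q1 q1' => [i x] [j y] /= -> -> -> /addIr ->.
- constructor 1; case: qp qs => _ pa p1 [_ sa s1].
  by case: p s pa sa p1 s1 => [i x] [j y] /= -> -> -> ->.
- by case: qp sq => qb _ _ [_ qa _]; case: ab; rewrite -qa.
Qed.

End GlueRelation.

(** * Copies, retractions and geodesics of the line *)

Section LineGeometry.
Context {R : realType} {X : complex R}.
Local Open Scope classical_set_scope.
Local Open Scope ring_scope.
Variables v vs : cell X.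
Local Notation L := (line v vs).
Implicit Types (i j k : int) (x y : pt X) (q : pt L).

Definition copy i x : pt L := cls _ (i, x).

Lemma copyP q : exists i x, q = copy i x.
Proof. by exists (rep q).1, (rep q).2; rewrite -{1}(repK q); case: (rep q). Qed.

Lemma line_chartE (c : cell L) (a : cube R (cdim c)) :
  chart c a = copy (rep c).1 (chart (rep c).2 a).
Proof. by []. Qed.

Lemma copy_glue i : copy i (vpt vs) = copy (i + 1) (vpt v).
Proof. by apply/clsP; apply: rst_step; split. Qed.

(** On representatives, the retraction of L[X] onto its k-th copy. It does not lengthen paths, and
    serves to compare distances, to distinguish points and to project connected sets. *)
Definition retract_pair k (p : int * pt X) : pt X :=
  if p.1 == k then p.2 else if k < p.1 then vpt vs else vpt v.

Definition retract k q : pt X := retract_pair k (rep q).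

Lemma retract_copy k i x : retract k (copy i x) = retract_pair k (i, x).
Proof.
rewrite /retract; have : clos_refl_sym_trans _ (glue_rel (vpt v) (vpt vs))
  (rep (copy i x)) (i, x) by apply/clsP; rewrite repK.
elim=> // [p q [pb qa q1]|p q s _ -> _ ->//].
rewrite /retract_pair q1; case: eqP => [<-|/eqP pk].
  by rewrite -subr_eq0 addrC addKr /= ltrDl ltr01.
case: eqP => [<-|/eqP qk]; first by rewrite ltNge lerDl ler01 qa.
by rewrite ltzD1 le_eqVlt (eq_sym k) (negPf pk).
Qed.

Lemma retract_same k x : retract k (copy k x) = x.
Proof. by rewrite retract_copy /retract_pair eqxx. Qed.

Lemma retract_right k i x : k < i -> retract k (copy i x) = vpt vs.
Proof. by rewrite retract_copy /retract_pair /= => ki; rewrite gt_eqF // ki. Qed.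

Lemma retract_left k i x : i < k -> retract k (copy i x) = vpt v.
Proof.
by rewrite retract_copy /retract_pair /= => ik; rewrite lt_eqF // ltNge (ltW ik).
Qed.

Lemma copy_inj i : injective (copy i).
Proof. by move=> x y /(congr1 (retract i)); rewrite !retract_same. Qed.

Definition lower i : set (pt L) := [set q | exists j x, j <= i /\ q = copy j x].
Definition upper i : set (pt L) := [set q | exists j x, i < j /\ q = copy j x].

(** Only vertices are glued: a change of representative happens in dimension 0, where it does not
    change the point carried by the cell. *)
Lemma cell_clos_dim (p p' : int * cell X) : is_vertex v -> is_vertex vs ->
  clos_refl_sym_trans _ (glue_rel v vs) p p' ->
  p = p' \/ [/\ cdim p.2 = 0%N, cdim p'.2 = 0%N
              & copy p.1 (vpt p.2) = copy p'.1 (vpt p'.2)].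
Proof.
move=> v0 vs0; elim=> {p p'} [p q [pb qa q1]|p|p q _|p q s _ IH _ IH'].
- by right; rewrite pb qa q1; split=> //; exact: copy_glue.
- by left.
- by case=> [->|[? ? ?]]; [left | right].
case: IH IH' => [->//|[p0 q0 pq]] [<-|[? s0 qs]]; first by right.
by right; split=> //; rewrite pq.
Qed.

Section Cells.
Hypotheses (v0 : is_vertex v) (vs0 : is_vertex vs).

(** The chart of the class may be taken at another representative than (i, c); both cubes are then
    points, and the constant map is the required isometry. *)
Lemma line_cellP i (c : cell X) :
  exists g : cube R (cdim c) -> cube R (cdim (cls _ (i, c) : cell L)),
    [/\ cube_isometry g, range g = setT,
        forall a, cube_interior a -> cube_interior (g a)
      & forall a, chart (cls _ (i, c) : cell L) (g a) = copy i (chart c a)].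
Proof.
have : clos_refl_sym_trans _ (glue_rel v vs) (i, c)
    (rep (cls (glue_rel v vs) (i, c))).
  by apply/clsP; rewrite repK.
rewrite /chart /= /line_chart /line_dim; move: (rep _) => p /(cell_clos_dim v0 vs0).
case=> [<-|[/= c0 p0 cp]]; first by exists id; split=> //; exact: image_id.
have oE n (a : cube R n) : n = 0%N -> a = origin n by move=> ?; exact: cube0_eq.
exists (fun=> origin _); split.
- by move=> a b; rewrite (oE _ a c0) (oE _ b c0) !cdistxx.
- by apply/seteqP; split=> // b _; exists (origin _) => //; rewrite (oE _ b p0).
- by move=> _ _ [k kp]; exfalso; rewrite p0 in kp.
- by move=> a; rewrite (oE _ a c0) -/(vpt c) -/(copy i _) cp.
Qed.

Lemma rep_cell i (c : cell X) : (0 < cdim c)%N ->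
  rep (cls (glue_rel v vs) (i, c)) = (i, c).
Proof.
move=> c0.
have : clos_refl_sym_trans _ (glue_rel v vs) (i, c)
    (rep (cls (glue_rel v vs) (i, c))).
  by apply/clsP; rewrite repK.
by case/(cell_clos_dim v0 vs0) => [<-//|[/= c0' _ _]]; rewrite c0' in c0.
Qed.

Lemma plpath_copy i x y l : plpath x y l -> plpath (copy i x) (copy i y) l.
Proof.
elim=> [z|c a b z k _ IH]; first exact: plpath_nil.
have [g [gi _ _ gc]] := line_cellP i c.
by rewrite -gc -gi; apply: plpath_cons; rewrite gc.
Qed.

Lemma plpath_retract k q q' l : plpath q q' l ->
  exists2 l', plpath (retract k q) (retract k q') l' & l' <= l.
Proof.
elim=> [z|c a b z m _ [l' IH lm]]; first by exists 0 => //; exact: plpath_nil.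
move: IH; rewrite !line_chartE !retract_copy /retract_pair /=.
case: eqP => _ IH.
  by exists (cdist a b + l'); [exact: plpath_cons | rewrite lerD2l].
by exists l' => //; apply: le_trans lm _; rewrite lerDr cdist_ge0.
Qed.

Lemma dist_retract k q q' : (dist (retract k q) (retract k q') <= dist q q')%E.
Proof.
apply: le_ereal_inf_tmp => _ [l /(plpath_retract k)[l' /dist_le d ll'] <-].
by apply: le_trans d _; rewrite lee_fin.
Qed.

Lemma dist_copy i x y : dist (copy i x) (copy i y) = dist x y.
Proof.
apply/eqP; rewrite eq_le; apply/andP; split.
  by apply: le_ereal_inf_tmp => _ [l /(plpath_copy i)/dist_le d <-].
by have := dist_retract i (copy i x) (copy i y); rewrite !retract_same.
Qed.

Lemma geodesic_copy i x y l c :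
  geodesic x y l c -> geodesic (copy i x) (copy i y) l (copy i \o c).
Proof.
move=> [l0 cx cy cD]; split=> //=; rewrite ?cx ?cy // => s t sl tl.
by rewrite dist_copy cD.
Qed.

Section Cuts.
Hypothesis vvs : vpt v <> vpt vs.

Lemma copy_eq i j x y : copy i x = copy j y ->
  [\/ (i, x) = (j, y), [/\ x = vpt vs, y = vpt v & j = i + 1]
    | [/\ y = vpt vs, x = vpt v & i = j + 1]].
Proof.
by move/clsP/(clos_glue vvs) => [->|[? ? ?]|[? ? ?]];
  [constructor 1 | constructor 2 | constructor 3].
Qed.

Lemma lower_upper i q : lower i q -> upper i q -> q = copy i (vpt vs).
Proof.
move=> [j [x [ji ->]]] [k [y [ik /copy_eq]]] [[jk _]|[-> _ kj]|[_ _ jk]].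
- by rewrite jk leNgt ik in ji.
- by congr copy; apply/eqP; rewrite eq_le ji -ltzD1 -kj.
- by move: ji; rewrite jk leNgt (lt_trans ik) // ltrDl.
Qed.

Lemma retract_separates q q' :
  (forall k, retract k q = retract k q') -> q = q'.
Proof.
wlog : q q' / exists i j x y, [/\ q = copy i x, q' = copy j y & i <= j].
  have [i [x qx]] := copyP q; have [j [y qy]] := copyP q' => wl qq.
  have [ij|ji] := leP i j; first by apply: wl => //; exists i, j, x, y.
  by symmetry; apply: wl => //; exists j, i, y, x; rewrite (ltW ji).
move=> [i [j [x [y [-> -> ij]]]]] rE.
move: ij; rewrite le_eqVlt => /orP[/eqP ij|ij].
  by have := rE i; rewrite ij !retract_same => ->.
have xE : x = vpt vs by have := rE i; rewrite retract_same retract_right.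
have yE : y = vpt v by have := rE j; rewrite retract_same retract_left.
rewrite xE yE copy_glue; congr copy; apply/eqP; rewrite eq_le lezD1 ij /=.
(* If i + 1 < j, the retraction onto copy i + 1 sends the two points to [v] and [vs], which are
   distinct. *)
rewrite leNgt; apply/negP => ij1; apply: vvs.
have i1 : i < i + 1 by rewrite ltrDl.
by have := rE (i + 1); rewrite (retract_left _ i1) (retract_right _ ij1).
Qed.

(** Each segment stays in one copy. The first one in a copy beyond i starts in both [lower i] and
    [upper i], hence at the gluing point. *)
Lemma plpath_split i q q' l : plpath q q' l -> lower i q -> upper i q' ->
  exists l1 l2, [/\ plpath q (copy i (vpt vs)) l1,
    plpath (copy i (vpt vs)) q' l2 & l1 + l2 = l].
Proof.
elim=> [z zl zu|c a b z m bz IH ca zu].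
  exists 0, 0; rewrite addr0 -(lower_upper zl zu).
  by split=> //; exact: plpath_nil.
have [ci|ic] := leP (rep c).1 i.
  have [|l1 [l2 [p1 p2 <-]]] := IH _ zu.
    by exists (rep c).1, (chart (rep c).2 b).
  exists (cdist a b + l1), l2; split=> //; last by rewrite addrA.
  exact: plpath_cons.
have E := lower_upper ca (ex_intro _ _ (ex_intro _ _ (conj ic (line_chartE a)))).
exists 0, (cdist a b + m); rewrite add0r -E; split=> //; first exact: plpath_nil.
exact: plpath_cons.
Qed.

Lemma dist_split i q q' : lower i q -> upper i q' ->
  (dist q q' = dist q (copy i (vpt vs)) + dist (copy i (vpt vs)) q')%E.
Proof.
move=> ql qu; apply/eqP; rewrite eq_le dist_triangle /=.
apply: le_ereal_inf_tmp => _ [l /plpath_split/(_ ql qu)[l1 [l2 [p1 p2 <-]]] <-].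
by rewrite EFinD leeD // dist_le.
Qed.

Section CAT0Line.
Hypothesis X0 : CAT0 X.

Let geoX x y : exists l c, geodesic x y l c.
Proof. by case: X0. Qed.

Lemma line_geodesic q q' : exists l c, geodesic q q' l c.
Proof.
suff up n i x y : exists l c, geodesic (copy i x) (copy (i + n%:Z) y) l c.
  have [i [x ->]] := copyP q; have [j [y ->]] := copyP q'.
  have [ij|/ltW ji] := leP i j.
    have -> : j = i + `|j - i|%N%:Z by lia.
    exact: up.
  have -> : i = j + `|i - j|%N%:Z by lia.
  have [l [c g]] := up `|i - j|%N j y x.
  by exists l, (fun s => c (l - s)); exact: geodesic_rev.
elim: n i x => [|n IH] i x.
  have [l [c g]] := geoX x y; exists l, (copy i \o c).
  by rewrite addr0; exact: geodesic_copy.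
have [k [c g]] := geoX x (vpt vs).
have [l [d h]] := IH (i + 1) (vpt v).
have -> : i + n.+1%:Z = i + 1 + n%:Z by rewrite -addrA -intS.
exists (k + l), (fun s => if s <= k then copy i (c s) else d (s - k)).
apply: geodesic_cat (geodesic_copy i g) _; last by rewrite copy_glue.
rewrite (dist_split (i := i)); last 2 first.
- by exists i, x.
- by exists (i + 1 + n%:Z), y; rewrite -addrA ltrDl.
by rewrite (geodesic_dist (geodesic_copy i g)) copy_glue (geodesic_dist h).
Qed.

Lemma line_separated q q' : dist q q' = 0%E -> q = q'.
Proof.
move=> qq; apply: retract_separates => k; case: X0 => _ sep _ _; apply: sep.
by apply/eqP; rewrite eq_le dist_ge0 andbT -qq dist_retract.
Qed.

Definition slab i (n : nat) : set (pt L) :=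
  [set q | exists j x, [/\ i <= j, j <= i + n%:Z & q = copy j x]].

(** Induction on the number of copies: the next copy meets the slab at one point through which
    distances add, as [CN_wedge] requires. *)
Lemma CN_slab i n : CN_on (@rdist R L) (slab i n).
Proof.
elim: n => [|n IH].
  move=> p q r m [j [x [j1 j2 ->]]] [j' [y [j1' j2' ->]]].
  move=> [j3 [z [j13 j23 ->]]] [j4 [w [j14 j24 ->]]].
  have E k : i <= k -> k <= i + 0 -> k = i.
    by rewrite addr0 => ? ?; apply/eqP; rewrite eq_le; apply/andP.
  rewrite (E j) // (E j') // (E j3) // (E j4) //.
  by rewrite /rdist !dist_copy; exact: (CAT0_CN X0).
pose A := slab i n; pose B := [set q | exists x, q = copy (i + n%:Z + 1) x].
have slabS : slab i n.+1 = A `|` B.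
  apply/seteqP; split=> q.
    move=> [j [x [ij jn ->]]]; have [lt|ge] := leP j (i + n%:Z).
      by left; exists j, x.
    by right; exists x; congr copy; lia.
  case=> [[j [x [ij jn ->]]]|[x ->]]; [exists j, x | exists (i + n%:Z + 1), x].
    by split=> //; lia.
  by split=> //; lia.
rewrite slabS; pose z := copy (i + n%:Z) (vpt vs).
have Bz : B z by exists (vpt v); exact: copy_glue.
apply: (@CN_wedge _ _ _ _ _ _ A B z) => //.
- exact: rdist_ge0.
- exact: rdistC.
- exact: rdist_triangle line_geodesic.
- by exists (i + n%:Z), (vpt vs); rewrite lerDl.
- move=> x y [j [x' [ij jn ->]]] [y' ->].
  rewrite /rdist (dist_split (i := i + n%:Z)); last 2 first.
  + by exists j, x'.
  + by exists (i + n%:Z + 1), y'; rewrite ltrDl.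
  by rewrite !(rdistE line_geodesic) -EFinD.
move=> p q r m [x ->] [y ->] [w ->] [t ->].
by rewrite /rdist !dist_copy; exact: (CAT0_CN X0).
Qed.

Lemma CAT0_line : CAT0 L.
Proof.
apply: CAT0_criterion.
- exact: line_geodesic.
- by exists (copy 0 (vpt v)).
- exact: line_separated.
move=> p r s t _ _ _ _.
have [i [x pE]] := copyP p; have [j [y rE]] := copyP r.
have [k [z sE]] := copyP s; have [l [w tE]] := copyP t.
(* The copies from -N to N contain the four points. *)
pose N := (`|i| + `|j| + `|k| + `|l|)%N.
have inN m u : (`|m| <= N)%N -> slab (- N%:Z) (N + N) (copy m u).
  move=> mN; exists m, u; rewrite PoszD addKr; split=> //; lia.
by apply: (@CN_slab (- N%:Z) (N + N)); rewrite ?pE ?rE ?sE ?tE; apply: inN;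
  rewrite /N; lia.
Qed.

End CAT0Line.
End Cuts.
End Cells.
End LineGeometry.

(** * The action on the line *)

Section LineComplex.
Context {R : realType} {X : complex R}.
Local Open Scope classical_set_scope.
Local Open Scope ring_scope.
Variables v vs : cell X.
Local Notation L := (line v vs).
Local Notation copy := (@copy R X v vs).
Implicit Types (i j k : int) (x y : pt X) (q : pt L).
Hypotheses (hX : cube_complex X) (v0 : is_vertex v) (vs0 : is_vertex vs).
Hypothesis vvs : vpt v <> vpt vs.

Let line_cellP := @line_cellP R X v vs v0 vs0.

Lemma origin_interior n : n = 0%N -> cube_interior (@origin R n).
Proof. by move=> n0 [i il]; exfalso; rewrite n0 in il. Qed.

Lemma vertex_cell (c : cell X) (a : cube R (cdim c)) (w : cell X) :
  is_vertex w -> cube_interior a -> chart c a = vpt w -> c = w.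
Proof.
move=> w0 ai aw; have := carrier_unique hX ai (origin_interior w0) aw.
by move=> /(congr1 (@projT1 _ _)).
Qed.

(** Either the points agree inside one copy, or they meet at a gluing point; an open cell containing
    that point is a vertex, so the cells are the identified copies of [v] and [vs]. *)
Lemma line_chart_inj (c d : cell L) (a : cube R (cdim c)) (b : cube R (cdim d)) :
  cube_interior a -> cube_interior b -> chart c a = chart d b ->
  existT (fun c => cube R (cdim c)) c a = existT _ d b.
Proof.
move=> ai bi cd.
have E : c = d.
  rewrite -(repK c) -(repK d); move: cd; rewrite !line_chartE.
  case/(copy_eq vvs) => [[ij xy]|[xv yv ij]|[yv xv ij]].
  - have := carrier_unique hX ai bi xy => /(congr1 (@projT1 _ _)) /= e.
    congr cls; case: (rep c) (rep d) ij e => [i c'] [j d'] /=.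
    by move=> -> ->.
  - have := vertex_cell vs0 ai xv; have := vertex_cell v0 bi yv => e e'.
    apply/clsP; apply: rst_step; split=> //.
  have := vertex_cell v0 ai xv; have := vertex_cell vs0 bi yv => e e'.
  by apply/clsP; apply: rst_sym; apply: rst_step; split.
case: d / E b bi cd => b bi.
rewrite !line_chartE => /copy_inj cd; congr existT.
exact: (chart_interior_inj hX).
Qed.

Lemma cube_complex_line : cube_complex L.
Proof.
split=> [q|c F].
  have [i [x ->]] := copyP q.
  have [[c a] [/= [ai ax] _]] := hX.1 x.
  have [g [_ _ gI gc]] := line_cellP i c.
  exists (existT _ (cls _ (i, c) : cell L) (g a)); split.
    by split; [exact: gI | rewrite -ax; exact: gc].
  move=> [d b] [/= bi bE]; apply: line_chart_inj => //; first exact: gI.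
  by apply: etrans (gc a) _; rewrite ax; exact: esym.
have [c' [g [gi gF gc]]] := hX.2 (rep c).2 F.
have [h [hi hT _ hc]] := line_cellP (rep c).1 c'.
exists (cls _ ((rep c).1, c')).
have /choice[h' h'K] : forall b, exists a, h a = b.
  by move=> b; have [a _ ab] : range h b; [rewrite hT | exists a].
have h'h a : h' (h a) = a by apply: (cube_isometry_inj hi); rewrite h'K.
exists (g \o h'); split.
- by move=> a b /=; rewrite gi -hi !h'K.
- rewrite -gF; apply/seteqP; split=> _ [a _ <-]; first by exists (h' a).
  by exists (h a) => //=; rewrite h'h.
by move=> a; have := hc (h' a); rewrite h'K => ->; rewrite -gc.
Qed.

Lemma finite_dimensional_line : finite_dimensional X -> finite_dimensional L.
Proof. by move=> [N XN]; exists N => c; exact: XN. Qed.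

End LineComplex.

Section LineAction.
Context {R : realType} {X : complex R}.
Local Open Scope classical_set_scope.
Local Open Scope ring_scope.
Variables v vs : cell X.
Local Notation L := (line v vs).
Local Notation copy := (@copy R X v vs).
Implicit Types (i j k : int) (x y : pt X) (q : pt L).

(** [shift_pt] and [Sigma_pt] are computed on a representative. The hypotheses are the compatibility
    with the gluing that makes the choice irrelevant. *)
Lemma copy_congr (f : int -> int) (h : int -> pt X -> pt X) :
  (forall i, h i (vpt v) = vpt v) -> (forall i, h i (vpt vs) = vpt vs) ->
  (forall i, f (i + 1) = f i + 1) ->
  forall i x,
  copy (f (rep (copy i x)).1) (h (rep (copy i x)).1 (rep (copy i x)).2) =
  copy (f i) (h i x).
Proof.
move=> hv hvs fS i x.
have : clos_refl_sym_trans _ (glue_rel (vpt v) (vpt vs)) (rep (copy i x)) (i, x).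
  by apply/clsP; rewrite repK.
suff gen p p' : clos_refl_sym_trans _ (glue_rel (vpt v) (vpt vs)) p p' ->
    copy (f p.1) (h p.1 p.2) = copy (f p'.1) (h p'.1 p'.2) by move/gen.
elim=> {p p'} // [p p' [pb qa q1]|p p' s _ -> _ ->//].
by rewrite pb qa q1 hv hvs fS copy_glue.
Qed.

Lemma shift_copy k i x : shift_pt k (copy i x) = copy (i + k) x.
Proof.
apply: (copy_congr (f := fun i => i + k) (h := fun _ => id)) => // j.
by rewrite addrAC.
Qed.

Lemma Sigma_copy (s : Sigma v vs) i x :
  Sigma_pt s (copy i x) = copy i (sval (sval s i) x).
Proof.
apply: (copy_congr (f := id) (h := fun i => sval (sval s i))) => // j.
- by case: (svalP (sval s j)).
- by case: (svalP (sval s j)).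
Qed.

Lemma line_act_copy (g : ZSigma v vs) i x :
  line_act g (copy i x) = copy (i + sdH g) (sval (sval (sdN g) (i + sdH g)) x).
Proof. by rewrite /line_act shift_copy Sigma_copy. Qed.

Lemma line_actM (g h : ZSigma v vs) q :
  line_act (g * h)%g q = line_act g (line_act h q).
Proof.
have [i [x ->]] := copyP q; rewrite !line_act_copy.
change (sdH (g * h)%g) with (sdH g + sdH h).
rewrite (addrC (sdH g)) addrA; congr copy.
change (sval (sdN (g * h)%g) (i + sdH h + sdH g)) with
 (sval (sdN g) (i + sdH h + sdH g) * sval (sdN h) (i + sdH h + sdH g - sdH g))%g.
by rewrite addrK.
Qed.

Lemma line_act1 q : line_act (1%g : ZSigma v vs) q = q.
Proof. by have [i [x ->]] := copyP q; rewrite line_act_copy addr0. Qed.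

Hypotheses (v0 : is_vertex v) (vs0 : is_vertex vs).

Lemma line_act_cubical (g : ZSigma v vs) : cubical (line_act g).
Proof.
move=> c; set i := (rep c).1 + sdH g.
have [[_ [_ _ fC _]] _ _] := svalP (sval (sdN g) i).
have [c' [h [hi hT hE]]] := fC (rep c).2.
have [e [ei eT _ eE]] := line_cellP v0 vs0 i c'.
exists (cls _ (i, c')), (e \o h); split.
- by move=> a b; rewrite /= ei hi.
- apply/seteqP; split=> // b _; have [a _ <-] : range e b by rewrite eT.
  by have [a' _ <-] : range h a; [rewrite hT | exists a'].
- by move=> a; rewrite line_chartE line_act_copy -/i hE; apply: esym; exact: eE.
Qed.

Lemma line_act_cubical_action : cubical_action (@line_act R X v vs).
Proof.
split; [exact: line_act1 | exact: line_actM |].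
move=> g; exists (line_act g^-1%g); split.
- by move=> q; rewrite -line_actM mulVg line_act1.
- by move=> q; rewrite -line_actM mulgV line_act1.
- exact: line_act_cubical.
- exact: line_act_cubical.
Qed.

Lemma copy_continuous i : continuous (copy i).
Proof.
move=> x A; rewrite -!nbhs_ballE => -[e e0 eA]; exists e => // y xy; apply: eA.
move: xy; rewrite /ball /= /dball.
by rewrite dist_copy.
Qed.

Definition translation k : ZSigma v vs := @SDPair Zgrp (Sigma v vs) _ 1%g k.

Lemma translation_copy k i x : line_act (translation k) (copy i x) = copy (i + k) x.
Proof. by rewrite line_act_copy. Qed.

Lemma line_cocompact : (forall x, exists c a, x = @chart R X c a) ->
  compact [set: pt X] -> cocompact (@line_act R X v vs).
Proof.
move=> onto cX.
have cell0 x : exists c a, (forall b, exists y, chart c b = copy 0 y) /\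
    copy 0 x = @chart R L c a.
  have [c [a ->]] := onto x; have [g [_ gT _ gc]] := line_cellP v0 vs0 0 c.
  exists (cls _ (0, c)), (g a); split; last by rewrite gc.
  move=> b; have [b' _ <-] : range g b by rewrite gT.
  by exists (chart c b'); rewrite gc.
(* Membership is tested on points, not on representatives: a gluing vertex of copy 0 may be
   represented in a neighbouring copy. *)
pose A : set (cell L) := [set c | forall a, exists x, chart c a = copy 0 x].
exists A; split.
- by move=> c F c' cA [g [_ _ gc]] a; rewrite -gc; exact: cA.
- have -> : carrier A = copy 0 @` setT.
    apply/seteqP; split=> q; last by move=> [x _ <-]; exact: cell0.
    by move=> [c [a [/(_ a)[x cx] ->]]]; exists x; rewrite ?cx.
  apply: continuous_compact => //; apply: continuous_subspaceT.
  exact: copy_continuous.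
move=> q; have [i [x ->]] := copyP q; exists (translation i), (copy 0 x).
  exact: cell0.
by rewrite translation_copy add0r.
Qed.

End LineAction.

(** * Hyperplanes of the line *)

Section Essential.
Context {R : realType} {X : complex R}.
Local Open Scope classical_set_scope.
Local Open Scope ring_scope.
Variables v vs : cell X.
Local Notation L := (line v vs).
Local Notation copy := (@copy R X v vs).
Local Notation cellcopy i c := (cls (glue_rel v vs) (i, c)).
Implicit Types (i j k : int) (x y : pt X) (q : pt L).

Lemma geodesic_continuous (Y : complex R) (p q : pt Y) l c :
  geodesic p q l c -> {within `[0, l], continuous c}.
Proof.
move=> [_ _ _ cD]; apply/subspace_continuousP => t /=; rewrite in_itv /= => tl.
move=> A; rewrite -!nbhs_ballE => -[e e0 eA].
exists e => // s /= ts sl; apply: eA; rewrite in_itv /= in sl.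
by rewrite /ball /= /dball cD // lte_fin.
Qed.

Lemma geodesic_connected (Y : complex R) (p q : pt Y) l c :
  geodesic p q l c -> connected (c @` `[0, l]).
Proof.
move=> g; apply: connected_continuous_connected (geodesic_continuous g).
exact: segment_connected.
Qed.

Lemma face_dim_gt0 (Y : complex R) (c c' : cell Y) (F : face (cdim c))
  (k : 'I_(cdim c)) : face_of F c' -> F k = None -> (0 < cdim c')%N.
Proof.
move=> [g [gi gF _]] Fk; rewrite lt0n; apply/negP => /eqP c0.
have [a _ ga] : range g (g (origin _)) by exists (origin _).
have wF : in_face F (g (origin _)) by rewrite -gF; exists (origin _).
have [a0 _ g0] : range g (upd (g (origin _)) k itv0).
  by rewrite gF; exact: in_face_upd.
have [a1 _ g1] : range g (upd (g (origin _)) k itv1).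
  by rewrite gF; exact: in_face_upd.
have := etrans (esym g0) (etrans (congr1 g (cube0_eq a0 a1 c0)) g1).
by move/(congr1 (fun a => ccoord a k)); rewrite !updE eqxx; lra.
Qed.

Lemma facet_free n (k : 'I_n) b : n = 2%N -> exists j : 'I_n, facet k b j = None.
Proof.
move=> n2; have : (0 < #|predC1 k|)%N by rewrite cardC1 card_ord n2.
by move=> /card_gt0P[j]; rewrite !inE => jk; exists j; rewrite ffunE (negPf jk).
Qed.

Hypotheses (hX : cube_complex X) (v0 : is_vertex v) (vs0 : is_vertex vs).
Hypothesis vvs : vpt v <> vpt vs.

(** [face_of] in L[X] with the representatives as variables: since the types of the cubes depend on
    them, they can then be replaced all at once. *)
Definition pair_face (p : int * cell X) (F : face (cdim p.2))
  (p' : int * cell X) :=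
  exists g : cube R (cdim p'.2) -> cube R (cdim p.2),
    [/\ cube_isometry g, range g = in_face F &
        forall a, copy p.1 (chart p.2 (g a)) = copy p'.1 (chart p'.2 a)].

Lemma pair_face_copy i (c c' : cell X) (F : face (cdim c)) :
  face_of F c' -> @pair_face (i, c) F (i, c').
Proof. by move=> [g [gi gF gc]]; exists g; split=> // a /=; rewrite gc. Qed.

Lemma barycenter_not_vertex (c w : cell X) : is_vertex w -> (0 < cdim c)%N ->
  barycenter c <> vpt w.
Proof.
move=> w0 c0 /(vertex_cell hX w0 (@center_interior R _)) cw.
by rewrite cw w0 in c0.
Qed.

(** The barycenter of a cell of positive dimension is no gluing point, so it determines the copy. *)
Lemma face_of_line (c c' : cell L) (F : face (cdim c)) :
  face_of F c' -> (0 < cdim c')%N ->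
  (rep c).1 = (rep c').1 /\ @face_of R X (rep c).2 F (rep c').2.
Proof.
move=> [g [gi gF gc]] c'0.
have idx : (rep c).1 = (rep c').1.
  have := gc (cube_center _); rewrite !line_chartE => /(copy_eq vvs).
  case=> [[->//]|[_ /(barycenter_not_vertex v0 c'0)//]|[]].
  by move/(barycenter_not_vertex vs0 c'0).
split=> //; exists g; split=> // a; have := gc a.
by rewrite !line_chartE idx => /copy_inj.
Qed.

Lemma opposite_edges_line (e e' : cell L) : opposite_edges e e' ->
  [/\ (rep e).1 = (rep e').1 & @opposite_edges R X (rep e).2 (rep e').2].
Proof.
move=> [s [k [s2 fe fe']]].
have [j fj] := facet_free k false s2; have [j' fj'] := facet_free k true s2.
have [i1 f1] := face_of_line fe (face_dim_gt0 fe fj).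
have [i2 f2] := face_of_line fe' (face_dim_gt0 fe' fj').
by split; [rewrite -i1 -i2 | exists (rep s).2, k].
Qed.

Lemma face_cell_dim (c c' : cell X) (F : face (cdim c)) :
  face_of F c' -> (0 < cdim c')%N -> (0 < cdim c)%N.
Proof.
move=> [g [gi _ _]] c'0; rewrite lt0n; apply/negP => /eqP c0.
have := cube_isometry_inj gi (cube0_eq (g (cube_center _)) (g (origin _)) c0).
by move=> /(congr1 (fun a => ccoord a (Ordinal c'0))); rewrite centerE ccoordE; lra.
Qed.

Lemma opposite_edges_copy i (e e' : cell X) : opposite_edges e e' ->
  opposite_edges (cellcopy i e : cell L) (cellcopy i e').
Proof.
move=> [s [k [s2 fe fe']]].
have [j fj] := facet_free k false s2; have [j' fj'] := facet_free k true s2.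
have Re := rep_cell v0 vs0 i (face_dim_gt0 fe fj).
have Re' := rep_cell v0 vs0 i (face_dim_gt0 fe' fj').
have Rs : rep (cellcopy i s) = (i, s) by apply: rep_cell; rewrite ?s2.
exists (cellcopy i s).
change (exists k0 : 'I_(cdim (rep (cellcopy i s)).2),
  [/\ cdim (rep (cellcopy i s)).2 = 2%N,
      pair_face (facet k0 false) (rep (cellcopy i e))
    & pair_face (facet k0 true) (rep (cellcopy i e'))]).
rewrite Rs Re Re'; exists k; split=> //; exact: pair_face_copy.
Qed.

Section Hyperplane.
Variable e0 : cell L.
Let i := (rep e0).1.
Let H := [set e | clos_refl_sym_trans _ (@opposite_edges R L) e0 e].
Let H' := [set e | clos_refl_sym_trans _ (@opposite_edges R X) (rep e0).2 e].

Let H_copy e : H e -> (rep e).1 = i /\ H' (rep e).2.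
Proof.
suff gen e1 : clos_refl_sym_trans _ (@opposite_edges R L) e1 e ->
    (rep e1).1 = (rep e).1 /\
    clos_refl_sym_trans _ (@opposite_edges R X) (rep e1).2 (rep e).2.
  by move/gen => [e1 ?]; split; [rewrite /i e1|].
elim=> {e1 e} [e e' /opposite_edges_line[ee' o]|e|e e' _ [-> IH]|
    e e' e'' _ [-> IH] _ [-> IH']]; split=> //.
- exact: rst_step.
- exact: rst_refl.
- exact: rst_sym.
- exact: rst_trans IH'.
Qed.

Let copy_H e : H' e -> H (cellcopy i e).
Proof.
suff gen e1 : clos_refl_sym_trans _ (@opposite_edges R X) e1 e ->
    clos_refl_sym_trans _ (@opposite_edges R L) (cellcopy i e1) (cellcopy i e).
  by move/gen; rewrite -surjective_pairing repK.
elim=> {e1 e} [e e' o|e|e e' _ IH|e e' e'' _ IH _ IH'].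
- exact/rst_step/opposite_edges_copy.
- exact: rst_refl.
- exact: rst_sym.
- exact: rst_trans IH'.
Qed.

Lemma midcubes_line_copy q :
  midcubes H q -> exists2 y, midcubes H' y & q = copy i y.
Proof.
move=> [c [k [a [-> ak [F [e [Fk fe He]]]]]]].
have Fkk : F k = None by apply/Fk.
have [ci fce] := face_of_line fe (face_dim_gt0 fe Fkk).
have [ei He'] := H_copy He.
exists (chart (rep c).2 a); last by rewrite line_chartE ci ei.
by exists (rep c).2, k, a; split=> //; exists F, (rep e).2.
Qed.

Lemma midcubes_copy_line y : midcubes H' y -> midcubes H (copy i y).
Proof.
move=> [c [k [a [-> ak [F [e [Fk fe He]]]]]]].
have Fkk : F k = None by apply/Fk.
have e_gt0 := face_dim_gt0 fe Fkk.
have Re := rep_cell v0 vs0 i e_gt0.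
have Rc := rep_cell v0 vs0 i (face_cell_dim fe e_gt0).
exists (cellcopy i c).
change (exists (k0 : 'I_(cdim (rep (cellcopy i c)).2))
  (a0 : cube R (cdim (rep (cellcopy i c)).2)),
  [/\ copy i (chart c a) =
        copy (rep (cellcopy i c)).1 (chart (rep (cellcopy i c)).2 a0),
      ccoord a0 k0 = 2^-1 &
      exists (F0 : face (cdim (rep (cellcopy i c)).2)) (e1 : cell L),
        [/\ forall t, F0 t = None <-> t = k0, pair_face F0 (rep e1) & H e1]]).
rewrite Rc; exists k, a; split=> //; exists F, (cellcopy i e); split=> //.
  by rewrite Re; exact: pair_face_copy.
exact: copy_H.
Qed.

Hypothesis opp : separates H' (vpt v) (vpt vs).

Lemma not_midcubes_other j x : j != i -> ~ midcubes H (copy j x).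
Proof.
move=> ji /midcubes_line_copy[y My /(copy_eq vvs)]; have [nv nvs _] := opp.
case=> [[ji' _]|[_ yv _]|[yvs _ _]].
- by rewrite ji' eqxx in ji.
- by apply: nv; rewrite -yv.
- by apply: nvs; rewrite -yvs.
Qed.

Lemma not_midcubes_left : ~ midcubes H (copy i (vpt v)).
Proof.
case: opp => nv _ _ /midcubes_line_copy[y My /copy_inj yv].
by apply: nv; rewrite yv.
Qed.

Lemma not_midcubes_right : ~ midcubes H (copy i (vpt vs)).
Proof.
case: opp => _ nv _ /midcubes_line_copy[y My /copy_inj yv].
by apply: nv; rewrite yv.
Qed.

Lemma retract_continuous k : continuous (@retract R X v vs k).
Proof.
move=> q A; rewrite -!nbhs_ballE => -[e e0' eA]; exists e => // q' qq'; apply: eA.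
move: qq'; rewrite /ball /= /dball; apply: le_lt_trans.
exact: dist_retract.
Qed.

(** A connected set avoiding the hyperplane retracts to a connected subset of X avoiding [H']: the
    other copies collapse to [v] and [vs], which are off [H']. This contradicts that [H'] separates
    [v] from [vs]. *)
Lemma left_right_separated :
  ~ connected_component (~` midcubes H) (copy i (vpt v)) (copy i (vpt vs)).
Proof.
move=> [B [Bv BM Bc] Bvs]; have [nv nvs] := opp; apply.
exists (retract i @` B); last first.
  by exists (copy i (vpt vs)) => //; exact: retract_same.
split.
- by exists (copy i (vpt v)) => //; exact: retract_same.
- move=> _ [q Bq <-]; have [j [x qx]] := copyP q.
  move: (BM _ Bq); rewrite qx => nM.
  have [ji|ij|ji] := ltgtP j i.
  + by rewrite retract_left.
  + by rewrite retract_right.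
  + by rewrite ji retract_same => /midcubes_copy_line; rewrite -ji.
apply: connected_continuous_connected Bc _; apply: continuous_subspaceT.
exact: retract_continuous.
Qed.

Hypothesis X0 : CAT0 X.

Lemma same_copy_connected j x y : j != i ->
  connected_component (~` midcubes H) (copy j x) (copy j y).
Proof.
move=> ji; have [_ _ geo _] := X0; have [l [c g]] := geo x y.
have g' := geodesic_copy v0 vs0 j g; have [l0 cx cy _] := g'.
exists ((copy j \o c) @` `[0, l]); last first.
  by exists l => //=; rewrite in_itv /= l0 lexx.
split; last exact: geodesic_connected g'.
- by exists 0 => //=; rewrite in_itv /= l0 lexx.
- by move=> _ [t _ <-]; exact: not_midcubes_other.
Qed.

Lemma right_connected n x :
  connected_component (~` midcubes H) (copy i (vpt vs)) (copy (i + 1 + n%:Z) x).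
Proof.
have ni m : i + 1 + m%:Z != i by apply/eqP; lia.
elim: n x => [|n IH] x.
  by rewrite copy_glue -{1}[i + 1]addr0; exact: same_copy_connected (ni 0).
apply: connected_component_trans (IH (vpt vs)) _; rewrite copy_glue.
have -> : i + 1 + n%:Z + 1 = i + 1 + n.+1%:Z by lia.
exact: same_copy_connected.
Qed.

Lemma left_connected n x :
  connected_component (~` midcubes H) (copy i (vpt v)) (copy (i - 1 - n%:Z) x).
Proof.
have ni m : i - 1 - m%:Z != i by apply/eqP; lia.
have gl j : copy j (vpt v) = copy (j - 1) (vpt vs) by rewrite copy_glue subrK.
elim: n x => [|n IH] x.
  by rewrite gl -{1}[i - 1]subr0; exact: same_copy_connected (ni 0).
apply: connected_component_trans (IH (vpt v)) _; rewrite gl.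
have -> : i - 1 - n%:Z - 1 = i - 1 - n.+1%:Z by lia.
exact: same_copy_connected.
Qed.

(** The n copies strictly in between must each be crossed from [v] to [vs]. *)
Lemma copies_far n j x y :
  ((n%:R * rdist (vpt v) (vpt vs))%:E <=
   dist (copy j x) (copy (j + 1 + n%:Z) y))%E.
Proof.
have geo : forall x y : pt X, exists l c, geodesic x y l c by case: X0.
have chain m k z : ((m%:R * rdist (vpt v) (vpt vs))%:E <=
    dist (copy k (vpt v)) (copy (k + m%:Z) z))%E.
  elim: m k => [|m IH] k; first by rewrite mul0r dist_ge0.
  rewrite (dist_split vvs (i := k)) //; last 2 first.
  - by exists k, (vpt v).
  - by exists (k + m.+1%:Z), z; split=> //; lia.
  rewrite dist_copy // (rdistE geo) copy_glue.
  have -> : k + m.+1%:Z = k + 1 + m%:Z by lia.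
  by rewrite -natr1 mulrDl mul1r addrC EFinD leeD2l.
rewrite (dist_split vvs (i := j)) //; last 2 first.
- by exists j, x.
- by exists (j + 1 + n%:Z), y; split=> //; lia.
rewrite copy_glue; apply: le_trans (chain n _ y) _.
by rewrite -[leLHS]add0e leeD ?dist_ge0.
Qed.

Lemma essential_halfspace h : halfspace H h ->
  forall (x : cell L) (r : R), exists g : ZSigma v vs, h (line_act g (vpt x)) /\
    forall z, midcubes H z -> (r%:E <= dist (line_act g (vpt x)) z)%E.
Proof.
move=> [p [q [_ HM ->]]] x r.
have [j [x0 xE]] := copyP (vpt x).
have [n rn] : exists n, r <= n%:R * rdist (vpt v) (vpt vs).
  have d0 : 0 < rdist (vpt v) (vpt vs).
    have [_ sep geo _] := X0; rewrite lt_def rdist_ge0 andbT; apply/eqP => d0.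
    by apply: vvs; apply: sep; rewrite (rdistE geo) d0.
  exists (Num.bound `|r / rdist (vpt v) (vpt vs)|).
  rewrite -ler_pdivrMr // ltW // (le_lt_trans (ler_norm _)) //.
  exact: archi_boundP.
pose C := connected_component (~` midcubes H).
have inC w : ~ midcubes H w -> C p w \/ C q w.
  by move=> nw; have : (C p `|` C q) w by rewrite -HM.
(* The component of [p] contains the left or the right gluing vertex of copy i; if both were in that
   of [q], the hyperplane would not separate them. *)
have [Lp|Lq] := inC _ not_midcubes_left.
  exists (translation v vs (i - 1 - n%:Z - j)); rewrite xE translation_copy //.
  have -> : j + (i - 1 - n%:Z - j) = i - 1 - n%:Z by lia.
  split.
    apply: subset_closure.
    exact: connected_component_trans Lp (left_connected _ _).
  move=> _ /midcubes_line_copy[y _ ->].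
  have := copies_far n (i - 1 - n%:Z) x0 y.
  have -> : i - 1 - n%:Z + 1 + n%:Z = i by lia.
  by apply: le_trans; rewrite lee_fin.
have [Rp|Rq] := inC _ not_midcubes_right.
  exists (translation v vs (i + 1 + n%:Z - j)); rewrite xE translation_copy //.
  have -> : j + (i + 1 + n%:Z - j) = i + 1 + n%:Z by lia.
  split.
    apply: subset_closure.
    exact: connected_component_trans Rp (right_connected _ _).
  move=> _ /midcubes_line_copy[y _ ->]; rewrite distC.
  by apply: le_trans (copies_far n i y x0); rewrite lee_fin.
exfalso; apply: left_right_separated.
exact: connected_component_trans (connected_component_sym Lq) Rq.
Qed.

End Hyperplane.

Lemma line_essential : CAT0 X -> diametrically_opposed v vs ->
  essential (@line_act R X v vs).
Proof.
move=> X0 opp H h [e0 [e0d ->]] hs x _ r.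
apply: essential_halfspace hs x r => //; apply: opp.
by exists (rep e0).2.
Qed.

End Essential.

(** * The standard cube *)

Section StandardCube.
Import numFieldNormedType.Exports.
Context {R : realType}.
Local Open Scope classical_set_scope.
Local Open Scope ring_scope.
Variable m : nat.
Local Notation S := (std_cube R m).
Implicit Types (F : face m) (x y : cube R m).

Lemma enum_face F i : F i = None ->
  exists j : 'I_(face_dim F), enum_val j = i.
Proof.
move=> Fi; have iF : i \in [pred i | F i == None] by rewrite inE Fi.
by exists (enum_rank_in iF i); rewrite enum_rankK_in.
Qed.

Lemma enum_faceN F (j : 'I_(face_dim F)) : F (enum_val j) = None.
Proof. by have := enum_valP j; rewrite inE => /eqP. Qed.

Lemma face_chart_free F (a : cube R (face_dim F)) j :
  ccoord (face_chart a) (enum_val j) = ccoord a j.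
Proof.
rewrite ccoordE /face_coord enum_faceN (big_pred1 j) // => k /=.
by rewrite (inj_eq enum_val_inj).
Qed.

Lemma face_chart_fixed F (a : cube R (face_dim F)) i b : F i = Some b ->
  ccoord (face_chart a) i = b%:R.
Proof. by move=> Fi; rewrite ccoordE /face_coord Fi. Qed.

Lemma in_face_chart F (a : cube R (face_dim F)) : in_face F (face_chart a).
Proof. by move=> i b; exact: face_chart_fixed. Qed.

Definition face_proj F x : cube R (face_dim F) :=
  mkcube (fun j : 'I_(face_dim F) => ccoord_itv x (enum_val j)).

Lemma face_projE F x j : ccoord (face_proj F x) j = ccoord x (enum_val j).
Proof. exact: ccoordE. Qed.

Lemma face_chartK F (a : cube R (face_dim F)) : face_proj F (face_chart a) = a.
Proof. by apply: cube_eq => j; rewrite face_projE face_chart_free. Qed.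

Lemma face_projK F x : in_face F x -> face_chart (face_proj F x) = x.
Proof.
move=> xF; apply: cube_eq => i; case Fi : (F i) => [b|].
  by rewrite (face_chart_fixed _ Fi) (xF _ _ Fi).
by have [j <-] := enum_face Fi; rewrite face_chart_free face_projE.
Qed.

Lemma face_chart_isometry F (a b : cube R (face_dim F)) :
  cdist (face_chart a) (face_chart b) = cdist a b.
Proof.
apply/eqP; rewrite -(@eqrXn2 _ 2) ?cdist_ge0 // !cdist_sq; apply/eqP.
rewrite (bigID (fun i => i \in [pred i | F i == None])) /= addrC big1 ?add0r.
  by rewrite big_enum_val; apply: eq_bigr => j _; rewrite !face_chart_free.
move=> i; rewrite inE; case Fi : (F i) => [t|] // _.
by rewrite !(face_chart_fixed _ Fi) subrr expr0n.
Qed.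

Lemma std_cube_complex : cube_complex S.
Proof.
split=> [x|F G].
  exists (existT (fun F => cube R (face_dim F)) (support_face x) (face_proj _ x)).
  split=> /=.
    split; last exact/face_projK/in_support_face.
    by move=> j; rewrite face_projE; apply/support_faceN/enum_faceN.
  move=> [F a] /= [ai ax]; have FE : support_face x = F.
    apply/ffunP => i; rewrite ffunE -ax; case Fi : (F i) => [[]|].
    - by rewrite (face_chart_fixed _ Fi) oner_eq0 eqxx.
    - by rewrite (face_chart_fixed _ Fi) eqxx.
    have [j <-] := enum_face Fi; rewrite face_chart_free.
    by have /andP[j0 j1] := ai j; rewrite gt_eqF // lt_eqF.
  case: F / FE a ai ax => a ai ax; congr existT.
  exact: etrans (congr1 (face_proj _) (esym ax)) (face_chartK a).
(* The face [G] of the face [F], read in the whole cube: coordinates fixed by [F] stay fixed, and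
   the j-th free one obeys [G j]. *)
pose F' : face m := [ffun i => if F i is Some b then Some b else
  if [pick j : 'I_(face_dim F) | enum_val j == i] is Some j then G j else None].
have F'G j : F' (enum_val j) = G j.
  rewrite ffunE enum_faceN; case: pickP => [k /eqP/enum_val_inj -> //|/(_ j)].
  by rewrite eqxx.
have F'F i b : F i = Some b -> F' i = Some b by rewrite ffunE => ->.
have sub (a : cube R (face_dim F')) : in_face F (face_chart a).
  by move=> i b /F'F Fi; exact: face_chart_fixed.
exists F', (face_proj F \o @face_chart R m F'); split.
- move=> a b /=; rewrite -[RHS]face_chart_isometry -(face_projK (sub a)).
  by rewrite -(face_projK (sub b)) face_chart_isometry !face_projK.
- apply/seteqP; split=> [_ [a _ <-] j b Gj|y yG] /=.
    by rewrite face_projE; apply: face_chart_fixed; rewrite F'G.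
  exists (face_proj F' (face_chart y)) => //=.
  rewrite face_projK ?face_chartK // => i b; case Fi : (F i) => [t|].
    by rewrite (F'F _ _ Fi) => -[<-]; exact: face_chart_fixed.
  by have [j <-] := enum_face Fi; rewrite F'G face_chart_free; exact: yG.
by move=> a /=; exact: face_projK.
Qed.

Let top : cell S := [ffun => None] : face m.

Lemma top_onto x : exists a, @face_chart R m top a = x.
Proof. by exists (face_proj top x); apply: face_projK => i b; rewrite ffunE. Qed.

Lemma std_cube_dist x y : dist (x : pt S) y = (cdist x y)%:E.
Proof.
apply/eqP; rewrite eq_le; apply/andP; split.
  have [a <-] := top_onto x; have [b <-] := top_onto y.
  by rewrite face_chart_isometry; exact: (@chart_dist R S top).
apply: le_ereal_inf_tmp => _ [l xyl <-]; rewrite lee_fin.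
elim: xyl => [z|c a b z k _ IH]; first by rewrite cdistxx.
apply: le_trans (cdist_triangle _ (face_chart b) _) _.
by rewrite /= face_chart_isometry lerD2l.
Qed.

(** [insubd] makes the segment total in [t]; for [t] in [0, 1] convexity of the cube excludes the
    default value. *)
Definition seg x y (t : R) : cube R m :=
  insubd x (val x + t *: (val y - val x)).

Lemma val_seg x y t :
  0 <= t <= 1 -> val (seg x y t) = val x + t *: (val y - val x).
Proof.
move=> t01; apply: insubdK; rewrite unfold_in; apply/forallP => i; rewrite !mxE.
have := ccoord_itv x i; have := ccoord_itv y i; rewrite /ccoord.
set a := fun_of_matrix _ _ _; set b := fun_of_matrix _ _ _ => ha hb.
have -> : b + t * (a - b) = (1 - t) * b + t * a by ring.
have /andP[t0 t1] := t01; have /andP[a0 a1] := ha; have /andP[b0 b1] := hb.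
rewrite addr_ge0 ?mulr_ge0 ?subr_ge0 //=.
have : (1 - t) * b + t * a <= (1 - t) * 1 + t * 1.
  by rewrite lerD // ler_wpM2l // subr_ge0.
by rewrite !mulr1 subrK.
Qed.

Lemma std_cube_geodesic x y : exists l (c : R -> pt S), geodesic (x : pt S) y l c.
Proof.
pose l := cdist x y; exists l, (fun s => seg x y (s / l)).
have [l0|ln] := eqVneq l 0.
  rewrite /geodesic l0 !mul0r; have <- : x = y by exact: cdist_eq0.
  have c0 : seg x x 0 = x.
    by apply: val_inj; rewrite val_seg ?itv0 // scale0r addr0.
  split=> // s t /andP[s0 s1] /andP[t0 t1].
  have -> : s = 0 by apply/eqP; rewrite eq_le s1.
  have -> : t = 0 by apply/eqP; rewrite eq_le t1.
  by rewrite distxx subrr normr0.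
have lp : 0 < l by rewrite lt_def ln cdist_ge0.
have in01 s : 0 <= s <= l -> 0 <= s / l <= 1.
  by move=> /andP[s0 sl]; rewrite divr_ge0 ?(ltW lp) //= ler_pdivrMr // mul1r.
split; first exact: ltW.
- by apply: val_inj; rewrite mul0r val_seg ?itv0 // scale0r addr0.
- by apply: val_inj; rewrite divff // val_seg ?itv1 // scale1r addrC subrK.
move=> s t /in01 sl /in01 tl; rewrite std_cube_dist; congr (_%:E).
apply/eqP; rewrite -(@eqrXn2 _ 2) ?cdist_ge0 //; apply/eqP.
rewrite /cdist euclid_sq !val_seg // sqd_two_sides -euclid_sq -/(cdist _ _) -/l.
have -> : sqd (val y) (val y) = 0.
  by rewrite -euclid_sq -/(cdist y y) cdistxx expr0n.
by rewrite real_normK ?num_real //; field.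
Qed.

(** An intermediate point in the metric sense is on the Euclidean segment, where Stewart's theorem
    gives the inequality as an equality. *)
Lemma std_cube_CAT0 : CAT0 S.
Proof.
have rE x y : rdist (x : pt S) y = cdist x y by rewrite /rdist std_cube_dist.
apply: CAT0_criterion; first exact: std_cube_geodesic.
- by exists (origin m).
- by move=> x y; rewrite std_cube_dist => -[] /cdist_eq0.
move=> p q r z _ _ _ _; rewrite !rE => qzr.
have [l0|ln] := eqVneq (cdist q r) 0.
  have := cdist_ge0 q z; have := cdist_ge0 z r => zr0 qz0.
  have -> : cdist q z = 0 by lra.
  have -> : cdist z r = 0 by lra.
  by rewrite l0 !mul0r; lra.
pose t := cdist q z / cdist q r.
have qz : cdist q z = t * cdist q r by rewrite /t divfK.
have zr : cdist z r = (1 - t) * cdist q r by rewrite mulrBl mul1r -qz; lra.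
have zE : val z = val q + t *: (val r - val q).
  apply: segment_unique; rewrite -!euclid_sq -!/(cdist _ _).
    by rewrite qz exprMn.
  by rewrite zr exprMn.
have -> : cdist p z ^+ 2 =
    (1 - t) * cdist p q ^+ 2 + t * cdist p r ^+ 2 - t * (1 - t) * cdist q r ^+ 2.
  by rewrite /cdist euclid_sq zE sqd_segment -!euclid_sq.
by rewrite le_eqVlt; apply/orP; left; apply/eqP; rewrite zr qz; ring.
Qed.

Lemma std_cube_compact : compact [set: pt S].
Proof.
pose K : set 'rV[R]_m := [set w : 'rV[R]_m | forall i, `[0, 1]%classic (w ord0 i)].
have cK : compact K.
  exact: (@rV_compact R m (fun=> `[0, 1]%classic) (fun=> @segment_compact R 0 1)).
pose f (w : 'rV[R]_m) : pt S := insubd (origin m) w.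
have fE w : K w -> val (f w) = w.
  move=> Kw; apply: insubdK; rewrite unfold_in; apply/forallP => i.
  by have := Kw i; rewrite /= in_itv.
have -> : [set: pt S] = f @` K.
  apply/seteqP; split=> // x _; exists (val x); last exact: valKd.
  by move=> i; rewrite /= in_itv; exact: (ccoord_itv x i).
apply: continuous_compact => //; apply/subspace_continuousP => w Kw A.
(* From the sup norm to the Euclidean distance: m (e / (m + 1))^2 < e^2, for m = 0 as well. *)
rewrite -!nbhs_ballE => -[e e0 eA]; exists (e / m.+1%:R) => /=.
  by rewrite divr_gt0.
move=> u wu Ku; apply: eA; rewrite /ball /= /dball std_cube_dist lte_fin.
rewrite -(@ltr_pXn2r _ 2) ?nnegrE ?cdist_ge0 ?(ltW e0) //.
rewrite /cdist euclid_sq !fE //.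
apply: (@le_lt_trans _ _ (\sum_(i < m) (e / m.+1%:R) ^+ 2)).
  apply: ler_sum => i _; rewrite -[leLHS]real_normK ?num_real //.
  rewrite ler_pXn2r ?nnegrE ?divr_ge0 ?(ltW e0) //; apply: ltW.
  by case: wu => _ /(_ ord0 i).
rewrite sumr_const card_ord -[ltLHS]mulr_natl expr_div_n mulrA.
rewrite ltr_pdivrMr ?exprn_gt0 //.
rewrite mulrC ltr_pM2l ?exprn_gt0 // -natrX ltr_nat.
by rewrite -mulnn leq_pmulr.
Qed.

Lemma corner_dim b : is_vertex (corner (R := R) m b).
Proof.
rewrite /is_vertex /= /face_dim; apply: eq_card0 => i.
by rewrite !inE ffunE.
Qed.

Lemma corner_coord b i : ccoord (vpt (corner (R := R) m b) : cube R m) i = b%:R.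
Proof. by apply: face_chart_fixed; rewrite ffunE. Qed.

Lemma ccoord_continuous i : continuous (fun x : pt S => ccoord x i : R^o).
Proof.
move=> x A; rewrite -!nbhs_ballE => -[e e0 eA]; exists e => // y.
rewrite /ball /= /dball std_cube_dist lte_fin => xy; apply: eA.
exact: le_lt_trans (ccoord_cdist _ _ _) xy.
Qed.

(** The hyperplane of an edge of direction i contains all points with i-th coordinate 1/2, so by
    intermediate values a connected set through both corners meets it. The corners avoid it, having
    no coordinate 1/2. *)
Lemma corners_opposed :
  diametrically_opposed (corner (R := R) m false) (corner m true).
Proof.
move=> H [e [e1 ->]]; set H' := [set _ | _].
have ce : (0 < face_dim e)%N by rewrite (e1 : face_dim e = 1%N).
pose i : 'I_m := enum_val (Ordinal ce).
have ei : (e : face m) i = None by exact: enum_faceN.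
have ei_uniq j : (e : face m) j = None -> j = i.
  move=> /enum_face[k <-]; congr enum_val; apply: val_inj => /=.
  by have := ltn_ord k; rewrite {2}(e1 : face_dim e = 1%N); case: (nat_of_ord k).
have half_mid x : ccoord x i = 2^-1 -> midcubes H' (x : pt S).
  move=> xi; have [k ki] : exists k : 'I_(face_dim top), enum_val k = i.
    by apply: enum_face; rewrite ffunE.
  have topK y : face_chart (face_proj top y) = y.
    by apply: face_projK => j b; rewrite ffunE.
  exists top, k, (face_proj top x); split; rewrite ?face_projE ?ki //.
    exact: esym (topK x).
  exists [ffun j => (e : face m) (enum_val j)], e; split.
  - move=> j; rewrite ffunE; split=> [/ei_uniq ji|->]; last by rewrite ki.
    by apply: enum_val_inj; rewrite ki.
  - exists (face_proj top \o @face_chart R m e); split.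
    + move=> a b /=; rewrite -[RHS](face_chart_isometry a).
      by rewrite -[LHS]face_chart_isometry !topK.
    + apply/seteqP; split=> [_ [a _ <-] j b|y yF] /=.
        by rewrite ffunE face_projE; exact: face_chart_fixed.
      exists (face_proj e (face_chart y)) => //=; rewrite face_projK ?face_chartK //.
      move=> j b ej; have [l lj] : exists l : 'I_(face_dim top), enum_val l = j.
        by apply: enum_face; rewrite ffunE.
      by rewrite -lj face_chart_free; apply: yF; rewrite ffunE lj.
    + by move=> a; exact: topK.
  - exact: rst_refl.
have corner_mid b : ~ midcubes H' (vpt (corner (R := R) m b)).
  move=> [c [k [a [xa ak _]]]].
  have := corner_coord b (enum_val k); rewrite xa face_chart_free ak.
  by case: (b) => /=; lra.
split=> //; move=> [B [Bv BM Bc] Bvs].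
have : is_interval ((fun x : pt S => ccoord (x : cube R m) i : R^o) @` B).
  apply/connected_intervalP; apply: connected_continuous_connected Bc _.
  exact/continuous_subspaceT/ccoord_continuous.
move=> itvB; have [||x Bx] := itvB 0 1 _ _ 2^-1 itv_half.
- by exists (vpt (corner m false)); rewrite ?corner_coord.
- by exists (vpt (corner m true)); rewrite ?corner_coord.
by move/half_mid; exact: BM.
Qed.

Definition permute_coords (s : 'S_m) x : cube R m :=
  mkcube (fun i => ccoord_itv x (s i)).

Lemma permute_coordsE s x i : ccoord (permute_coords s x) i = ccoord x (s i).
Proof. exact: ccoordE. Qed.

Lemma permute_coords_isometry s : cube_isometry (permute_coords s).
Proof.
move=> x y; apply/eqP; rewrite -(@eqrXn2 _ 2) ?cdist_ge0 // !cdist_sq; apply/eqP.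
rewrite [RHS](reindex_inj (@perm_inj _ s)); apply: eq_bigr => i _.
by rewrite !permute_coordsE.
Qed.

Lemma permute_coords1 : permute_coords 1%g = id.
Proof. by apply/funext => x; apply: cube_eq => i; rewrite permute_coordsE perm1. Qed.

(** Precomposition reverses products, and so does the MathComp convention that [s * t] applies [s]
    first; the two reversals cancel. *)
Lemma permute_coordsM s t x :
  permute_coords (s * t)%g x = permute_coords s (permute_coords t x).
Proof. by apply: cube_eq => i; rewrite !permute_coordsE permM. Qed.

Lemma permute_coords_cubical s : cubical (permute_coords s : pt S -> pt S).
Proof.
move=> F; pose F' : face m := [ffun i => (F : face m) (s i)].
have sub x : in_face F x -> in_face F' (permute_coords s x).
  by move=> xF i b; rewrite ffunE permute_coordsE; exact: xF.
exists F', (fun a => face_proj F' (permute_coords s (@face_chart R m F a))); split.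
- move=> a b; rewrite -[LHS]face_chart_isometry.
  rewrite !face_projK; try exact/sub/in_face_chart.
  by rewrite permute_coords_isometry face_chart_isometry.
- apply/seteqP; split=> // y _.
  have yF : in_face F (permute_coords s^-1 (face_chart y)).
    move=> i b Fi; rewrite permute_coordsE; apply: face_chart_fixed.
    by rewrite ffunE permKV.
  exists (face_proj F (permute_coords s^-1 (face_chart y))) => //.
  by rewrite face_projK // -permute_coordsM mulgV permute_coords1 face_chartK.
by move=> a; rewrite /= face_projK //; exact/sub/in_face_chart.
Qed.

Lemma permute_coords_fixing s :
  fixing_aut (corner (R := R) m false) (corner m true) (permute_coords s).
Proof.
have fix_corner b : permute_coords s (vpt (corner m b)) = vpt (corner m b).
  by apply: cube_eq => i; rewrite permute_coordsE !corner_coord.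
split=> //; exists (permute_coords s^-1); split.
- by move=> x; rewrite -permute_coordsM mulVg permute_coords1.
- by move=> x; rewrite -permute_coordsM mulgV permute_coords1.
- exact: permute_coords_cubical.
- exact: permute_coords_cubical.
Qed.

Definition perm_aut (s : 'S_m) : FixAut (corner (R := R) m false) (corner m true) :=
  exist _ _ (permute_coords_fixing s).

Lemma perm_autM : {morph perm_aut : s t / (s * t)%g}.
Proof. by move=> s t; apply: Aut_eq => x; exact: permute_coordsM. Qed.

Let basis i : cube R m := upd (origin m) i itv1.

Let basisE i j : ccoord (basis i) j = (j == i)%:R.
Proof. by rewrite updE ccoordE; case: (j == i). Qed.

Let basis_inj : injective basis.
Proof.
move=> i j /(congr1 (fun a => ccoord a i)); rewrite !basisE eqxx.
by case: eqP => // _ /eqP; rewrite oner_eq0.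
Qed.

Lemma perm_aut_inj : injective perm_aut.
Proof.
move=> s t /(congr1 sval)/= st; apply/permP => i.
have := congr1 (fun f => ccoord (f (basis (s i)) : cube R m) i) st.
rewrite /= !permute_coordsE !basisE eqxx; case: eqP => // _ /eqP.
by rewrite oner_eq0.
Qed.

(** An automorphism fixing the origin is an isometry permuting the vertices at distance 1 from it,
    and a point is determined by its distances to the origin and to these vertices. *)
Lemma perm_aut_onto f : exists s, perm_aut s = f.
Proof.
have [[f' [fK f'K fC f'C]] f0 _] := svalP f.
pose h : cube R m -> cube R m := sval f.
have hi : cube_isometry h.
  move=> x y; have [c' [g [gi gT gE]]] := fC top.
  have [a <-] := top_onto x; have [b <-] := top_onto y.
  by rewrite /h !gE /= !face_chart_isometry gi.
have hT : range h = setT.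
  by apply/seteqP; split=> // x _; exists (f' x) => //; exact: f'K.
have h0 : h (origin m) = origin m.
  suff <- : vpt (corner m false) = origin m :> cube R m by [].
  by apply: cube_eq => i; rewrite corner_coord ccoordE.
have hb i : exists j, h (basis i) = basis j.
  have hv : cube_vertex (h (basis i)) by apply/isometry_vertex => //; exact: unit_vertex.
  have sumE : \sum_k ccoord (h (basis i)) k ^+ 2 = 1.
    have := cdist_sq (h (basis i)) (origin m).
    rewrite -{1}h0 hi cdist_sq (bigD1 i) //= basisE eqxx.
    rewrite big1 => [|k /negPf ki]; last first.
      by rewrite basisE ki ccoordE subr0 expr0n.
    rewrite ccoordE subr0 expr1n addr0 => ->; apply: eq_bigr => k _.
    by rewrite ccoordE subr0.
  have [j hj] : exists j, ccoord (h (basis i)) j = 1.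
    apply: contrapT => none; move: sumE; rewrite big1 => [/eqP|k _].
      by rewrite eq_sym oner_eq0.
    by case: (hv k) => [->|k1]; [rewrite expr0n | case: none; exists k].
  exists j; apply: cube_eq => k; rewrite basisE; case: eqP => [->//|/eqP kj].
  move: sumE; rewrite (bigD1 j) //= hj expr1n => /eqP.
  rewrite -subr_eq0 addrAC subrr add0r psumr_eq0 => [|? _]; last exact: sqr_ge0.
  by move=> /allP/(_ k (mem_index_enum _)); rewrite kj /= sqrf_eq0 => /eqP.
have [p pE] := choice hb.
have pI : injective p.
  by move=> i j pij; apply/basis_inj/(cube_isometry_inj hi); rewrite !pE pij.
(* The inverse, because coordinate [p k] of the image of [x] is coordinate [k] of [x]. *)
exists (perm pI)^-1%g; apply: Aut_eq => x; apply: cube_eq => i /=.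
rewrite permute_coordsE; set k := (perm pI)^-1%g i.
have -> : i = p k by rewrite -(permE pI) permKV.
have := cdist_sq_unit (h x) (p k); rewrite -/(basis _) -pE -{1}h0 !hi.
by rewrite cdist_sq_unit /h; lra.
Qed.

Lemma FixAut_corners :
  isomorphic (FixAut (corner (R := R) m false) (corner m true)) 'S_m.
Proof.
apply: isomorphic_sym; exists perm_aut; split; last exact: perm_autM.
have [g gK] := choice perm_aut_onto.
by exists g => // s; apply: perm_aut_inj; rewrite gK.
Qed.

End StandardCube.

(** * Conclusion *)

Section Nondegeneracy.
Context {R : realType} {X : complex R}.
Local Open Scope classical_set_scope.
Local Open Scope ring_scope.
Hypothesis hX : cube_complex X.

Lemma edge_exists (c : cell X) :
  (0 < cdim c)%N -> exists e : cell X, cdim e = 1%N.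
Proof.
move=> c0; pose k := Ordinal c0.
pose F : face (cdim c) := [ffun j => if j == k then None else Some false].
have [e fe] := hX.2 c F; exists e.
have Fk : F k = None by rewrite ffunE eqxx.
have e0 := face_dim_gt0 fe Fk; case: fe => g [gi gF _].
apply/eqP; rewrite eqn_leq e0 andbT leqNgt; apply/negP => e1.
(* Two unit vectors are at distance sqrt 2, more than the length of the face. *)
pose u i : cube R (cdim e) := upd (origin _) i itv1.
have := cdist_sq_unit (u (Ordinal e0)) (Ordinal e1).
rewrite cdist_sq (bigD1 (Ordinal e0)) //= big1 => [|j /negPf j0]; last first.
  by rewrite updE j0 !ccoordE subrr expr0n.
rewrite !updE eqxx ccoordE subr0 expr1n addr0 /= ccoordE -[cdist _ _ in LHS]gi.
rewrite cdist_sq (bigD1 k) //= big1 => [|j /negPf jk]; last first.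
  have inF a : in_face F (g a) by rewrite -gF; exists a.
  have Fj : F j = Some false by rewrite ffunE jk.
  by rewrite !(inF _ _ _ Fj) subrr expr0n.
set x := ccoord _ _; set y := ccoord _ _.
have : (x - y) ^+ 2 <= 1 ^+ 2.
  have x01 : 0 <= x <= 1 by exact: ccoord_itv.
  have y01 : 0 <= y <= 1 by exact: ccoord_itv.
  by apply: sqr_diff_le; lra.
rewrite expr1n addr0; lra.
Qed.

(** No hyperplane separates a point from itself, so equal points would exclude edges, hence all
    cubes of positive dimension. Paths are then constant, X is a point by connectedness, and its
    automorphism group is trivial. *)
Lemma opposed_distinct (v vs : cell X) : CAT0 X -> diametrically_opposed v vs ->
  ~ solvable_group (FixAut v vs) -> vpt v <> vpt vs.
Proof.
move=> [_ _ geo _] opp nsol vvs; apply: nsol; exists 0%N => f _ /=.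
have no_edge (c : cell X) : cdim c = 0%N.
  apply/eqP; rewrite -leqn0 leqNgt; apply/negP => /edge_exists[e e1].
  have [] := opp _ (ex_intro _ e (conj e1 erefl)); rewrite -vvs => nv _; apply.
  exact: connected_component_refl.
have path_eq (x y : pt X) l : plpath x y l -> x = y.
  by elim=> // c a b z k _ <-; rewrite (cube0_eq a b (no_edge c)).
apply: Aut_eq => x /=; have [l [c g]] := geo (sval f x) x.
(* The distance is finite, being the length of a geodesic, so some path joins the two points. *)
have : dball (sval f x) (l + 1) x.
  by rewrite /dball (geodesic_dist g) lte_fin ltrDl.
by move=> /dballP[k /path_eq].
Qed.

End Nondegeneracy.

Section LineOfCompactComplex.
Context {R : realType} {X : complex R}.
Local Open Scope classical_set_scope.
Variables v vs : cell X.
Hypotheses (hX : cube_complex X) (X0 : CAT0 X) (cX : compact [set: pt X]).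
Hypotheses (v0 : is_vertex v) (vs0 : is_vertex vs).
Hypotheses (opp : diametrically_opposed v vs).
Hypothesis nsol : ~ solvable_group (FixAut v vs).

Lemma ZSigma_commutator_exponent : exists2 N, (0 < N)%N &
  forall x y : ZSigma v vs, ([~ x, y] ^+ N = 1)%g.
Proof.
have [T [h hI]] := compact_FixAut_finite hX cX v vs.
have [N N0 AN] := finite_exponent hI.
by exists N => //; exact: lamplighter_exponent.
Qed.

Lemma ZSigma_not_virtually_solvable : ~ virtually_solvable (ZSigma v vs).
Proof. exact: lamplighter_not_virtually_solvable. Qed.

Lemma ZSigma_finitely_generated : finitely_generated (ZSigma v vs).
Proof.
have [T [h hI]] := compact_FixAut_finite hX cX v vs.
have [s sA] := finite_listing hI.
exact: lamplighter_finitely_generated sA.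
Qed.

Lemma ZSigma_girth : (girth R (ZSigma v vs) < +oo)%E.
Proof.
have [N N0 GN] := ZSigma_commutator_exponent.
exact: comm_power_girth N0 GN ZSigma_not_virtually_solvable.
Qed.

Lemma line_CAT0_cube_complex :
  [/\ cube_complex (line v vs), CAT0 (line v vs) & finite_dimensional (line v vs)].
Proof.
have vvs := opposed_distinct hX X0 opp nsol; split.
- exact: cube_complex_line.
- exact: CAT0_line.
- exact/finite_dimensional_line/compact_finite_dimensional.
Qed.

Lemma line_action : [/\ cubical_action (@line_act R X v vs),
  essential (@line_act R X v vs) & cocompact (@line_act R X v vs)].
Proof.
have vvs := opposed_distinct hX X0 opp nsol; split.
- exact: line_act_cubical_action.
- exact: line_essential.
- exact: line_cocompact (chart_onto hX) cX.
Qed.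

Lemma ZSigma_cocompactly_cubulated : cocompactly_cubulated R (ZSigma v vs).
Proof.
have [hL CL fL] := line_CAT0_cube_complex; have [aL _ cL] := line_action.
split; first exact: ZSigma_finitely_generated.
by exists (line v vs), (@line_act R X v vs).
Qed.

End LineOfCompactComplex.

Lemma corners_not_solvable (R : realType) m : (5 <= m)%N ->
  ~ solvable_group (FixAut (corner (R := R) m false) (corner m true)).
Proof.
by move=> m5 /(isomorphic_solvable (FixAut_corners m)); exact: Sym_not_solvable.
Qed.

Local Open Scope classical_set_scope.

Theorem mainTheorem4 (R : realType) :
  (forall (X : complex R) (v vs : cell X),
     cube_complex X -> CAT0 X -> compact [set: pt X] ->
     is_vertex v -> is_vertex vs -> diametrically_opposed v vs ->
     ~ solvable_group (FixAut v vs) ->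
     [/\ isomorphic (ZSigma v vs) (wreath (FixAut v vs) Zgrp),
         [/\ cube_complex (line v vs), CAT0 (line v vs)
           & finite_dimensional (line v vs)],
         [/\ cubical_action (@line_act R X v vs),
             essential (@line_act R X v vs)
           & cocompact (@line_act R X v vs)],
         ~ virtually_solvable (ZSigma v vs)
       & satisfies_law (ZSigma v vs)]) /\
  (~ girth_alternative R (cocompactly_cubulated R) /\
   exists G : groupType, [/\ cocompactly_cubulated R G,
     ~ virtually_solvable G & (girth R G < +oo)%E]) /\
  (forall m : nat,
     let v := corner (R := R) m false in
     let vs := corner (R := R) m true in
     [/\ [/\ cube_complex (std_cube R m), CAT0 (std_cube R m)
           & compact [set: pt (std_cube R m)]],
         [/\ is_vertex v, is_vertex vs & diametrically_opposed v vs],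
         isomorphic (FixAut v vs) 'S_m
       & (5 <= m)%N ->
         [/\ ~ solvable_group (FixAut v vs),
             isomorphic (ZSigma v vs) (wreath 'S_m Zgrp),
             finitely_generated (ZSigma v vs) /\
             [/\ cube_complex (line v vs), CAT0 (line v vs),
                 finite_dimensional (line v vs),
                 cubical_action (@line_act R (std_cube R m) v vs)
               & cocompact (@line_act R (std_cube R m) v vs)],
             ~ virtually_solvable (ZSigma v vs)
           & (girth R (ZSigma v vs) < +oo)%E]]).
Proof.
split; last split.
- move=> X v vs hX X0 cX v0 vs0 opp nsol; split.
  + exact/lamplighter_wreath/isomorphic_refl.
  + exact: line_CAT0_cube_complex.
  + exact: line_action.
  + exact: ZSigma_not_virtually_solvable.
  + have [N N0 GN] := ZSigma_commutator_exponent v vs hX cX.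
    exact: comm_power_law N0 GN.
- have ex : exists G : groupType, [/\ cocompactly_cubulated R G,
      ~ virtually_solvable G & (girth R G < +oo)%E].
    have nsol := @corners_not_solvable R 5 isT.
    exists (ZSigma (corner (R := R) 5 false) (corner 5 true)); split.
    + by apply: ZSigma_cocompactly_cubulated; [exact: std_cube_complex
        | exact: std_cube_CAT0 | exact: std_cube_compact | exact: corner_dim
        | exact: corner_dim | exact: corners_opposed | ].
    + exact: ZSigma_not_virtually_solvable.
    + by apply: ZSigma_girth => //; [exact: std_cube_complex | exact: std_cube_compact].
  split=> // GA; have [G [CG nvs gG]] := ex.
  by case: (GA G CG) => // gE; rewrite gE ltxx in gG.
move=> m v vs; split.
- by split; [exact: std_cube_complex | exact: std_cube_CAT0 | exact: std_cube_compact].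
- by split; [exact: corner_dim | exact: corner_dim | exact: corners_opposed].
- exact: FixAut_corners.
move=> m5; have nsol := corners_not_solvable (R := R) m5.
have hX := @std_cube_complex R m; have X0 := @std_cube_CAT0 R m.
have cX := @std_cube_compact R m; have opp := @corners_opposed R m.
have cd := @corner_dim R m.
have [hL CL fL] := line_CAT0_cube_complex hX X0 cX (cd false) (cd true) opp nsol.
have [aL _ cL] := line_action hX X0 cX (cd false) (cd true) opp nsol.
split=> //.
- exact/lamplighter_wreath/FixAut_corners.
- by split=> //; exact: ZSigma_finitely_generated.
- exact: ZSigma_not_virtually_solvable.
- exact: ZSigma_girth.
Qed.
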